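(* Let $$a=\begin{pmatrix}1&1\\0&1\end{pmatrix},\qquad b=\begin{pmatrix}1&0\\1&1\end{pmatrix},$$ let $S=\{a,b\}\subset \mathrm{SL}_2(\mathbb{R})$, and for $p\in(0,1)$ let $\mu_p:=p\delta_a+(1-p)\delta_b$. Then $J(S)=[0,\log R(S)]$ is a closed interval of positive length, but there is $R'(S)>0$ with $R'(S)<R(S)$ such that $(0,\log R'(S)]$ is the set of values attained by the Lyapunov exponent $\vec{\lambda}_{\mu_p}=\lambda_1(\mu_p)$ as $p$ varies in $(0,1)$.
   Context: Let $\|\cdot\|$ be the Euclidean operator norm on $2\times2$ matrices and $S^n=\{g_1\cdots g_n:g_i\in S\}$. The joint spectral radius is $R(S)=\lim_{n\to+\infty}\sup_{g\in S^n}\|g\|^{1/n}$. The Cartan projection of $g\in \mathrm{SL}_2(\mathbb{R})$ is identified with the number $\kappa(g)=\log\|g\|\in[0,+\infty)$, and the joint spectrum $J(S)\subset[0,+\infty)$ is the limit in the Hausdorff metric of the sets $\frac1n\kappa(S^n)=\{\frac1n\log\|g\|:g\in S^n\}$ as $n\to+\infty$. The Lyapunov exponent $\lambda_1(\mu)$ of a finitely supported probability measure $\mu$ on $\mathrm{SL}_2(\mathbb{R})$ is the almost sure limit of $\frac1n\log\|g_1\cdots g_n\|$, where $(g_n)_{n\ge1}$ are independent with common law $\mu$. *)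

(* Defs.v *)
From HB Require Import structures.
From mathcomp Require Import all_boot all_order all_algebra.
From mathcomp Require Import finmap.
From mathcomp Require Import all_classical all_reals all_analysis.
Set Implicit Arguments.
Unset Strict Implicit.
Unset Printing Implicit Defensive.
Import Order.TTheory GRing.Theory Num.Theory.
Import numFieldNormedType.Exports.
Local Open Scope classical_set_scope.
Local Open Scope ring_scope.

Section Euclidean.
Context {R : realType}.

Definition eucl_norm (v : 'cV[R]_2) : R := Num.sqrt (\sum_(i < 2) v i 0 ^+ 2).

Definition op_norm (g : 'M[R]_2) : R :=
  sup [set eucl_norm (g *m v) | v in [set v | eucl_norm v <= 1]].

Definition cartan (g : 'M[R]_2) : R := ln (op_norm g).

(* S^n, products in the order g_1 ... g_n *)
Definition prod_set (S : set 'M[R]_2) (n : nat) : set 'M[R]_2 :=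
  [set \prod_(i < n) g i | g in [set g : 'I_n -> 'M[R]_2 | forall i, S (g i)]].

Definition joint_spectral_radius (S : set 'M[R]_2) : R :=
  limn (fun n => sup [set op_norm g `^ n%:R^-1 | g in prod_set S n]).

Definition hausdorff_dist (A B : set R) : \bar R :=
  Order.max (ereal_sup [set edist_inf B x | x in A])
            (ereal_sup [set edist_inf A x | x in B]).

(* The Hausdorff metric is a metric on nonempty compact sets. *)
Definition is_hausdorff_lim (K : nat -> set R) (J : set R) : Prop :=
  [/\ J !=set0, compact J & hausdorff_dist (K n) J @[n --> \oo] --> 0%E].

Definition joint_spectrum (S : set 'M[R]_2) : set R :=
  xget set0
    [set J | is_hausdorff_lim
       (fun n => [set n%:R^-1 * cartan g | g in prod_set S n]) J].

(* Borel sigma-algebra on 2x2 matrices; a measure on SL_2 is seen as a measure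
   on this space carried by matrices of determinant 1. *)
Definition borelM2 := g_sigma_algebraType (@open 'M[R]_2).

End Euclidean.
Arguments borelM2 : clear implicits.

Section Lyapunov.
Context {R : realType}.
Implicit Types mu : probability (borelM2 R) R.

Definition iid d (T : measurableType d) (P : probability T R)
    (g : nat -> {RV P >-> borelM2 R}) mu : Prop :=
  (forall n A, measurable A -> distribution P (g n) A = mu A) /\
  (forall (J : {fset nat}) (A : nat -> set (borelM2 R)),
     (forall i, measurable (A i)) ->
     P (\bigcap_(i in [set` J]) (g i @^-1` A i)) =
     (\prod_(i <- J) P (g i @^-1` A i))%E).

(* The indices are shifted: the first factor of the product is g 0. *)
Definition is_lyapunov_exponent mu (l : R) : Prop :=
  forall d (T : measurableType d) (P : probability T R)
    (g : nat -> {RV P >-> borelM2 R}),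
  iid g mu ->
  {ae P, forall w,
     n%:R^-1 * ln (op_norm (\prod_(i < n) (g i w : 'M[R]_2))) @[n --> \oo] --> l}.

Definition lyapunov_exponent mu : R := xget 0 [set l | is_lyapunov_exponent mu l].

End Lyapunov.

Section TwoPointMeasure.
Context {R : realType}.
Implicit Types (x y : borelM2 R) (p : R).

Definition two_point x y p (p01 : 0 < p < 1) : set (borelM2 R) -> \bar R :=
  fun A => (p%:E * \d_x A + (1 - p)%:E * \d_y A)%E.

Variables (x y : borelM2 R) (p : R) (p01 : 0 < p < 1).

Let p_ge0 : 0 <= p. Proof. by case/andP: p01 => /ltW. Qed.

Let q_ge0 : 0 <= 1 - p.
Proof. by case/andP: p01 => _ /ltW; rewrite subr_ge0. Qed.

Let two_pointE : two_point x y p01 =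
  measure_add (mscale (NngNum p_ge0) \d_x) (mscale (NngNum q_ge0) \d_y).
Proof. by apply/funext => A; rewrite measure_addE. Qed.

Let two_point0 : two_point x y p01 set0 = 0%E.
Proof. by rewrite /two_point !measure0 !mule0 adde0. Qed.

Let two_point_ge0 A : (0 <= two_point x y p01 A)%E.
Proof. by rewrite two_pointE; exact: measure_ge0. Qed.

Let two_point_sigma_additive : semi_sigma_additive (two_point x y p01).
Proof. by rewrite two_pointE; exact: measure_semi_sigma_additive. Qed.

HB.instance Definition _ := isMeasure.Build _ _ _ (two_point x y p01)
  two_point0 two_point_ge0 two_point_sigma_additive.

Let two_pointT : two_point x y p01 [set: _] = 1%:E.
Proof. by rewrite /two_point !diracT !mule1 -EFinD addrC subrK. Qed.

HB.instance Definition _ := @Measure_isProbability.Build _ _ R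
  (two_point x y p01) two_pointT.

End TwoPointMeasure.

Definition mat_a (R : realType) : 'M[R]_2 :=
  \matrix_(i, j) nth 0 (nth [::] [:: [:: 1; 1]; [:: 0; 1]] i) j.

Definition mat_b (R : realType) : 'M[R]_2 :=
  \matrix_(i, j) nth 0 (nth [::] [:: [:: 1; 0]; [:: 1; 1]] i) j.

Definition S_ab (R : realType) : set 'M[R]_2 := [set mat_a R; mat_b R].
Arguments S_ab : clear implicits.

Lemma S_ab_SL2 (R : realType) : S_ab R `<=` [set g | \det g = 1].
Proof.
by move=> g [->|->] /=; rewrite (expand_det_row _ ord0) !big_ord_recl big_ord0
  /cofactor !det_mx11 !mxE /= expr0 expr1 ?mulr0 ?mul0r ?addr0 ?mulr1.
Qed.

Definition mu_ab (R : realType) (p : R) (p01 : 0 < p < 1) :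
    probability (borelM2 R) R :=
  two_point (mat_a R) (mat_b R) p01.

(* Main.v *)
Require Import Defs.
From mathcomp Require Import all_boot all_order all_algebra.
From mathcomp Require Import finmap ring lra.
From mathcomp Require Import all_classical all_reals all_analysis.
From mathcomp Require Import measurable_realfun.
Set Implicit Arguments.
Unset Strict Implicit.
Unset Printing Implicit Defensive.
Import Order.TTheory GRing.Theory Num.Theory.
Import numFieldNormedType.Exports.
Local Open Scope classical_set_scope.
Local Open Scope ring_scope.

(** The reason behind the theorem is that the joint spectrum and the Lyapunov
exponent see the same finite words in [a] and [b], but the former sees every
word while the latter sees only averages over Bernoulli words.

Growth of words.  On nonnegative vectors [(s, t)], the extremal norm
[max (phi s + t) (s + phi t)], where [phi] is the golden ratio, is multiplied by
at most [phi] by [a] and by [b] ([gauge_letter]), and alternating words achieve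
this growth ([mass_alternating]); so [R(S) = phi].  An alternating word of length [j]
followed by a power of [a] has log-norm [j ln phi] up to a logarithmic error,
because powers of [a] grow only linearly; letting [j] vary fills the interval
[[0, ln phi]], which is therefore the joint spectrum ([joint_spectrumE]).

The Lyapunov function.  For a word [w] of length [n], the sum of the entries of
its matrix is submultiplicative, the top left entry is supermultiplicative, the
operator norm lies between the two, and they differ by a factor of at most
[(n + 2)^2] ([mass_le_corner]).  The averages of their logarithms over words of
length [n] with Bernoulli([p]) letters, divided by [n], thus squeeze a single
number [lyap p], with an error [2 ln (n + 2) / n] that does not depend on [p].
These averages are polynomials in [p], so [lyap] is continuous on [[0, 1]].  It
vanishes at [0] and [1], where only powers of [b] or of [a] remain, it is
positive in between since [ab] has top left entry [2], and it stays below
[ln phi] since the word [aaa], which has positive probability, expands the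
extremal norm by a factor less than [phi^3] ([gauge_aaa]).  By the extreme and
the intermediate value theorems its values on (0, 1) fill [(0, lyap c]] for some
[c], and [R' = exp (lyap c)].

Identification with the almost sure limit.  A subadditive function of words
exceeds [n] times (its mean rate plus [e]) with exponentially small probability
([subadditive_tail], by a Chernoff bound whose exponential moments are
submultiplicative).  Borel-Cantelli, applied to the logarithm of the sum of
entries and to minus the logarithm of the top left entry, gives the almost sure
limit [lyap p] ([lyap_is_lyapunov_exponent]).  The exponent is defined by a
quantification over all independent sequences, so its uniqueness needs one such
sequence to exist: the digits of the expanding map of [[0, 1]] with branches of
slopes [1 / p] and [1 / (1 - p)] under the uniform law ([letter_seq_iid]). *)

(** * Words in the two matrices *)

Section Words.
Context {R : realType}.
Implicit Types (A B : 'M[R]_2) (u v w : seq bool) (c : bool).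

Definition letter c : 'M[R]_2 := if c then mat_a R else mat_b R.

Definition wordmx w : 'M[R]_2 := \prod_(c <- w) letter c.

Definition corner A : R := A 0 0.

Definition mass A : R := A 0 0 + A 0 1 + A 1 0 + A 1 1.

Definition nonneg A := forall i j, 0 <= A i j.

Lemma mulmx2E A B i j : (A * B) i j = A i 0 * B 0 j + A i 1 * B 1 j.
Proof.
by rewrite mxE !big_ord_recl big_ord0 addr0; congr (_ + A i _ * B _ j);
  exact/val_inj.
Qed.

Lemma ord2P (P : 'I_2 -> Prop) : P 0 -> P 1 -> forall i, P i.
Proof.
move=> P0 P1 [[|[|//]] hi].
- by have <- : 0 = Ordinal hi by exact/val_inj.
- by have <- : 1 = Ordinal hi by exact/val_inj.
Qed.

Lemma mat_aE : ((mat_a R 0 0 = 1) * (mat_a R 0 1 = 1) *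
  (mat_a R 1 0 = 0) * (mat_a R 1 1 = 1))%type.
Proof. by rewrite !mxE. Qed.

Lemma mat_bE : ((mat_b R 0 0 = 1) * (mat_b R 0 1 = 0) *
  (mat_b R 1 0 = 1) * (mat_b R 1 1 = 1))%type.
Proof. by rewrite !mxE. Qed.

Lemma mx1E : (((1 : 'M[R]_2) 0 0 = 1) * ((1 : 'M[R]_2) 0 1 = 0) *
  ((1 : 'M[R]_2) 1 0 = 0) * ((1 : 'M[R]_2) 1 1 = 1))%type.
Proof. by rewrite !mxE. Qed.

Lemma wordmx_nil : wordmx [::] = 1.
Proof. exact: big_nil. Qed.

Lemma wordmx_cons c w : wordmx (c :: w) = letter c * wordmx w.
Proof. exact: big_cons. Qed.

Lemma wordmx_cat u v : wordmx (u ++ v) = wordmx u * wordmx v.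
Proof. exact: big_cat. Qed.

Lemma wordmx_rcons w c : wordmx (rcons w c) = wordmx w * letter c.
Proof. by rewrite -cats1 wordmx_cat /wordmx big_seq1. Qed.

Lemma nonneg_letter c : nonneg (letter c).
Proof.
by case: c; apply: ord2P; apply: ord2P; rewrite /= ?mat_aE ?mat_bE.
Qed.

Lemma nonnegM A B : nonneg A -> nonneg B -> nonneg (A * B).
Proof. by move=> hA hB i j; rewrite mulmx2E addr_ge0// mulr_ge0. Qed.

Lemma nonneg_wordmx w : nonneg (wordmx w).
Proof.
elim: w => [|c w ih].
  by rewrite wordmx_nil; apply: ord2P; apply: ord2P; rewrite mx1E.
by rewrite wordmx_cons; apply: nonnegM => //; exact: nonneg_letter.
Qed.

Lemma corner_supermult A B : nonneg A -> nonneg B ->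
  corner A * corner B <= corner (A * B).
Proof. by move=> hA hB; rewrite /corner mulmx2E lerDl mulr_ge0. Qed.

Lemma mass_submult A B : nonneg A -> nonneg B ->
  mass (A * B) <= mass A * mass B.
Proof.
move=> hA hB; rewrite /mass !mulmx2E -subr_ge0.
have hh i j k l : 0 <= A i j * B k l by rewrite mulr_ge0.
have -> (a b c d e f g h : R) :
  (a + b + c + d) * (e + f + g + h) - (a * e + b * g + (a * f + b * h)
    + (c * e + d * g) + (c * f + d * h)) =
  a * g + a * h + b * e + b * f + (c * g + c * h + d * e + d * f) by ring.
by rewrite !addr_ge0.
Qed.

Lemma corner_le_mass A : nonneg A -> corner A <= mass A.
Proof. by move=> hA; rewrite /corner /mass -!addrA lerDl !addr_ge0. Qed.

Lemma corner_ge1 w : 1 <= corner (wordmx w).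
Proof.
elim: w => [|c w ih]; first by rewrite wordmx_nil /corner mx1E.
rewrite wordmx_cons (le_trans _ (corner_supermult _ _))//.
- by rewrite {1}/corner; case: c; rewrite /= ?mat_aE ?mat_bE mul1r.
- exact: nonneg_letter.
- exact: nonneg_wordmx.
Qed.

Lemma mass_ge1 w : 1 <= mass (wordmx w).
Proof.
by rewrite (le_trans (corner_ge1 w))// corner_le_mass//; exact: nonneg_wordmx.
Qed.

(** Left multiplication by [a] makes the first row dominate the second; by [b] it
adds the first row to the second once.  The bound on the ratio of the row sums
therefore grows by at most one per letter.  [top_row_le] is the analogue for
right multiplication and the columns. *)
Lemma row_sum_le w : let A := wordmx w in
  A 1 0 + A 1 1 <= (size w).+1%:R * (A 0 0 + A 0 1).
Proof.
elim: w => [|c w ih] /=; first by rewrite wordmx_nil !mx1E; lra.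
have h := nonneg_wordmx w.
have h00 := h 0 0; have h01 := h 0 1; have h10 := h 1 0; have h11 := h 1 1.
rewrite wordmx_cons !mulmx2E; case: c; rewrite /= ?mat_aE ?mat_bE.
  set m := (size w).+2%:R; have hm : 1 <= m by rewrite ler1n.
  rewrite !(mul1r, mul0r) add0r.
  apply: (@le_trans _ _ (1 * (wordmx w 0 0 + wordmx w 1 0 +
    (wordmx w 0 1 + wordmx w 1 1)))); first lra.
  by rewrite ler_wpM2r// !addr_ge0.
by rewrite -natr1; move: ih => /=; set m := (size w).+1%:R => ih; lra.
Qed.

Lemma top_row_le w : let A := wordmx w in A 0 1 <= (size w)%:R * A 0 0.
Proof.
elim/last_ind: w => [|w c ih] /=; first by rewrite wordmx_nil !mx1E; lra.
have h := nonneg_wordmx w.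
have h00 := h 0 0; have h01 := h 0 1.
rewrite wordmx_rcons !mulmx2E size_rcons; case: c; rewrite /= ?mat_aE ?mat_bE.
  by rewrite -natr1; move: ih => /= ih; lra.
set m := (size w).+1%:R; have hm : 1 <= m by rewrite ler1n.
rewrite !(mulr1, mulr0) add0r.
apply: (@le_trans _ _ (1 * (wordmx w 0 0 + wordmx w 0 1))); first lra.
by rewrite ler_wpM2r// addr_ge0.
Qed.

(** The polynomial gap between the submultiplicative and the supermultiplicative
size of a word; all the limits below rest on it. *)
Lemma mass_le_corner w :
  mass (wordmx w) <= (size w).+2%:R ^+ 2 * corner (wordmx w).
Proof.
have := row_sum_le w; have := top_row_le w; have := corner_ge1 w.
rewrite /corner /mass /=; set n := size w.
rewrite -(natr1 n.+1) -(natr1 n) => c1 h1 h2.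
have n0 : 0 <= n%:R :> R by [].
nra.
Qed.

End Words.

(** * The Euclidean operator norm *)

Section OperatorNorm.
Context {R : realType}.
Implicit Types (A : 'M[R]_2) (v : 'cV[R]_2).

Lemma eucl_normE v : eucl_norm v = Num.sqrt (v 0 0 ^+ 2 + v 1 0 ^+ 2).
Proof.
rewrite /eucl_norm !big_ord_recl big_ord0 addr0.
by congr (Num.sqrt (_ + v _ _ ^+ 2)); exact/val_inj.
Qed.

Lemma eucl_norm_ge v i : `|v i 0| <= eucl_norm v.
Proof.
rewrite eucl_normE -sqrtr_sqr ler_wsqrtr//.
by move: i; apply: ord2P; rewrite ?lerDl ?lerDr sqr_ge0.
Qed.

Lemma eucl_norm_le v : eucl_norm v <= `|v 0 0| + `|v 1 0|.
Proof.
have h : 0 <= `|v 0 0| + `|v 1 0| by rewrite addr_ge0.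
rewrite eucl_normE -(ger0_norm h) -sqrtr_sqr ler_wsqrtr//.
rewrite sqrrD !real_normK ?num_real// lerD2r lerDl.
by rewrite mulrn_wge0// mulr_ge0.
Qed.

Lemma mulmx_colE A v i : (A *m v) i 0 = A i 0 * v 0 0 + A i 1 * v 1 0.
Proof.
by rewrite mxE !big_ord_recl big_ord0 addr0; congr (_ + A i _ * v _ 0);
  exact/val_inj.
Qed.

Lemma eucl_norm_mul_le A v : nonneg A -> eucl_norm v <= 1 ->
  eucl_norm (A *m v) <= mass A.
Proof.
move=> hA hv; rewrite (le_trans (eucl_norm_le _))// !mulmx_colE.
have h i j : `|A i j * v j 0| <= A i j.
  rewrite normrM (ger0_norm (hA _ _)) ler_piMr//.
  exact: le_trans (eucl_norm_ge _ _) hv.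
rewrite /mass -addrA lerD// (le_trans (ler_normD _ _))// lerD//.
Qed.

Lemma op_norm_le_mass A : nonneg A -> op_norm A <= mass A.
Proof.
move=> hA; apply: ge_sup => [|_ [v hv <-]]; last exact: eucl_norm_mul_le.
exists (eucl_norm (A *m 0)), 0 => //=.
by rewrite eucl_normE !mxE !expr0n /= addr0 sqrtr0.
Qed.

Lemma corner_le_op_norm A : nonneg A -> corner A <= op_norm A.
Proof.
move=> hA; pose e : 'cV[R]_2 := delta_mx 0 0.
have he : eucl_norm e <= 1.
  by rewrite eucl_normE !mxE/= expr1n expr0n addr0 sqrtr1.
apply: le_trans (ub_le_sup _ (x := eucl_norm (A *m e)) _); last by exists e.
- apply: le_trans (eucl_norm_ge _ 0).
  by rewrite mulmx_colE !mxE/= mulr1 mulr0 addr0 ler_norm.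
- by exists (mass A) => _ [v hv <-]; exact: eucl_norm_mul_le.
Qed.

End OperatorNorm.

(** * An extremal norm for the golden ratio *)

Section Golden.
Context {R : realType}.
Implicit Types (A : 'M[R]_2) (w : seq bool) (c : bool).

Definition golden : R := (1 + Num.sqrt 5) / 2.

Local Notation phi := golden.

Lemma golden_sqr : golden ^+ 2 = golden + 1.
Proof.
rewrite /golden expr_div_n sqrrD sqr_sqrtr// expr1n mul1r.
by field.
Qed.

Lemma golden_gt1 : 1 < golden.
Proof.
have : (1 : R) < Num.sqrt 5 by rewrite -[ltLHS]sqrtr1 ltr_sqrt// ltr1n.
by rewrite /golden; lra.
Qed.

Lemma golden_gt0 : 0 < golden.
Proof. exact: lt_trans golden_gt1. Qed.

(** The extremal norm evaluated at [A] applied to the vector [(1, 1)]. *)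
Definition gauge A : R :=
  let s := A 0 0 + A 0 1 in let t := A 1 0 + A 1 1 in
  Num.max (phi * s + t) (s + phi * t).

Lemma mass_le_gauge A : nonneg A -> mass A <= gauge A.
Proof.
move=> hA; rewrite /gauge /mass /= le_max; apply/orP; left.
by rewrite -addrA lerD2r ler_peMl ?addr_ge0// ltW// golden_gt1.
Qed.

(** Both forms defining the norm are carried by [a] and [b] to forms dominated by
[phi] times the norm, because [phi ^ 2 = phi + 1]. *)
Lemma gauge_letter c A : nonneg A -> gauge (letter c * A) <= phi * gauge A.
Proof.
move=> hA; rewrite /gauge /= !mulmx2E.
set s := A 0 0 + A 0 1; set t := A 1 0 + A 1 1.
have s0 : 0 <= s by rewrite addr_ge0.
have t0 : 0 <= t by rewrite addr_ge0.
have p1 : 1 < phi := golden_gt1.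
have p2 : phi ^+ 2 = phi + 1 := golden_sqr.
have sp : s <= phi * s by rewrite ler_peMl// ltW.
have tp : t <= phi * t by rewrite ler_peMl// ltW.
set G := Num.max (phi * s + t) _.
have [g1 g2] : phi * s + t <= G /\ s + phi * t <= G.
  by split; rewrite le_max lexx ?orbT.
have {g1} g1 : phi * (phi * s + t) <= phi * G by rewrite ler_pM2l ?golden_gt0.
have {g2} g2 : phi * (s + phi * t) <= phi * G by rewrite ler_pM2l ?golden_gt0.
have e1 : phi * (phi * s + t) = phi * s + s + phi * t.
  by rewrite mulrDr mulrA -expr2 p2; ring.
have e2 : phi * (s + phi * t) = phi * s + phi * t + t.
  by rewrite mulrDr [in X in _ + X]mulrA -expr2 p2; ring.
rewrite e1 in g1; rewrite e2 in g2.
by rewrite ge_max; case: c; rewrite /= ?mat_aE ?mat_bE;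
  rewrite !(mul1r, mul0r, add0r, addr0);
  (have -> : A 0 0 + A 1 0 + (A 0 1 + A 1 1) = s + t by rewrite /s /t; ring);
  rewrite -/s -/t; apply/andP; split; lra.
Qed.

(** The factor [phi + 2] is smaller than [phi ^ 3 = 2 phi + 1]: repeating [a] three times
loses a definite amount against the extremal growth. *)
Lemma gauge_aaa A : nonneg A ->
  gauge (wordmx [:: true; true; true] * A) <= (phi + 2) * gauge A.
Proof.
move=> hA; rewrite !wordmx_cons wordmx_nil mulr1 -!mulrA /gauge /= !mulmx2E.
rewrite /= !mat_aE !(mul1r, mul0r, add0r, addr0).
set s := A 0 0 + A 0 1; set t := A 1 0 + A 1 1.
have s0 : 0 <= s by rewrite addr_ge0.
have t0 : 0 <= t by rewrite addr_ge0.
have p1 : 1 < phi := golden_gt1.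
have p2 : phi ^+ 2 = phi + 1 := golden_sqr.
have sp : s <= phi * s by rewrite ler_peMl// ltW.
have tp : t <= phi * t by rewrite ler_peMl// ltW.
set G := Num.max (phi * s + t) _.
have g2 : (phi + 2) * (s + phi * t) <= (phi + 2) * G.
  by rewrite ler_pM2l ?le_max ?lexx ?orbT// addr_gt0// golden_gt0.
have e2 : (phi + 2) * (s + phi * t) = phi * s + 2 * s + (3 * (phi * t) + t).
  rewrite mulrDr.
  rewrite [X in _ + X](_ : _ = phi ^+ 2 * t + 2 * (phi * t)); last by ring.
  by rewrite p2; ring.
rewrite e2 in g2.
have -> : A 0 0 + A 1 0 + A 1 0 + A 1 0 + (A 0 1 + A 1 1 + A 1 1 + A 1 1) =
    s + 3 * t.
  by rewrite /s /t; ring.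
by rewrite ge_max mulrDr; apply/andP; split; lra.
Qed.

Lemma gauge1 : gauge 1 = phi + 1.
Proof.
rewrite /gauge /= !mx1E addr0 add0r !mulr1 max_l//.
by rewrite addrC.
Qed.

Lemma gauge_wordmx w : gauge (wordmx w) <= phi ^+ (size w).+2.
Proof.
elim: w => [|c w ih] /=; first by rewrite wordmx_nil gauge1 golden_sqr.
rewrite wordmx_cons (le_trans (gauge_letter _ _))//; first exact: nonneg_wordmx.
by rewrite exprS ler_pM2l ?golden_gt0.
Qed.

Lemma mass_wordmx_le w : mass (wordmx w) <= phi ^+ (size w).+2.
Proof.
by rewrite (le_trans (mass_le_gauge _))//; [exact: nonneg_wordmx|
  exact: gauge_wordmx].
Qed.

Fixpoint alternating c n : seq bool :=
  if n is m.+1 then c :: alternating (~~ c) m else [::].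

Lemma size_alternating c n : size (alternating c n) = n.
Proof. by elim: n c => //= n ih c; rewrite ih. Qed.

(** [a] maps [(1, phi)] to [phi (phi, 1)] and [b] maps [(phi, 1)] to
[phi (1, phi)], so an alternating word stretches one of these two vectors by
exactly [phi] at each letter. *)
Lemma alternating_eigen c n : let A := wordmx (alternating c n) in
  exists x y, [/\ 0 <= x <= phi, 0 <= y <= phi,
    A 0 0 * x + A 0 1 * y = phi ^+ n * (if c then phi else 1) &
    A 1 0 * x + A 1 1 * y = phi ^+ n * (if c then 1 else phi)].
Proof.
have p1 : 1 < phi := golden_gt1.
have p2 : phi ^+ 2 = phi + 1 := golden_sqr.
elim: n c => [|n ih] c /=.
  exists (if c then phi else 1), (if c then 1 else phi).
  by rewrite wordmx_nil !mx1E !mul0r !mul1r add0r addr0; split=> //;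
    case: c; apply/andP; split; lra.
have [x [y [hx hy h1 h2]]] := ih (~~ c).
have distr (q r s t : R) : (q + r) * x + (s + t) * y =
  (q * x + s * y) + (r * x + t * y) by ring.
exists x, y; split => //; rewrite wordmx_cons !mulmx2E;
  move: h1 h2; case: c => /= h1 h2;
  rewrite ?mat_aE ?mat_bE !(mul1r, mul0r, add0r, addr0) ?mulr1 in h1 h2 *.
- rewrite distr.
  by rewrite h1 h2 exprSr -mulrA -expr2 p2; ring.
- by rewrite h1 exprSr.
- by rewrite h2 exprSr.
- rewrite distr.
  by rewrite h1 h2 exprSr -mulrA -expr2 p2; ring.
Qed.

Lemma mass_alternating c n : phi ^+ n <= mass (wordmx (alternating c n)).
Proof.
have [x [y [/andP[x0 x1] /andP[y0 y1] h1 h2]]] := alternating_eigen c n.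
have hA := nonneg_wordmx (alternating c n) : nonneg (wordmx _ : 'M[R]_2).
have p1 : 1 < phi := golden_gt1.
rewrite -(ler_pM2r golden_gt0) /mass !mulrDl.
apply: (@le_trans _ _ (phi ^+ n * phi + phi ^+ n)).
  by rewrite lerDl exprn_ge0// ltW// golden_gt0.
apply: (@le_trans _ _ (phi ^+ n * (if c then phi else 1) +
   phi ^+ n * (if c then 1 else phi))).
  by case: c {h1 h2 hA}; rewrite mulr1 // addrC.
by rewrite -h1 -h2 -!addrA !lerD// ler_wpM2l.
Qed.

Lemma corner_nseq c n : corner (wordmx (nseq n c) : 'M[R]_2) = 1.
Proof.
suff : (wordmx (nseq n c) : 'M[R]_2) 0 0 = 1 /\
       (if c then (wordmx (nseq n c) : 'M[R]_2) 1 0 = 0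
        else (wordmx (nseq n c) : 'M[R]_2) 0 1 = 0) by case.
elim: n => [|n [h1 h2]]; first by rewrite wordmx_nil !mx1E; case: c.
by rewrite wordmx_cons !mulmx2E; move: h2; case: c {h1} (h1) => h1 h2;
  rewrite /= ?mat_aE ?mat_bE ?h1 ?h2; split; ring.
Qed.

End Golden.

(** * Averages over Bernoulli words *)

Section Expectation.
Context {R : realType}.
Implicit Types (p : R) (F G : seq bool -> R) (u v w : seq bool).

(** The mean of [F] over words of [n] independent letters, each equal to [true]
with probability [p].  The recursion on the first letter shows that it is a
polynomial in [p] for every real [p]. *)
Fixpoint expect p n F : R :=
  if n is m.+1 then
    p * expect p m (fun w => F (true :: w)) +
    (1 - p) * expect p m (fun w => F (false :: w))
  else F [::].

Lemma eq_expect p n F G : (forall w, size w = n -> F w = G w) ->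
  expect p n F = expect p n G.
Proof.
elim: n F G => [|n ih] F G h /=; first exact: h.
by congr (_ * _ + _ * _); apply: ih => w hw; apply: h; rewrite /= hw.
Qed.

Lemma expect_cst p n (r : R) : expect p n (fun=> r) = r.
Proof. by elim: n => //= n ->; ring. Qed.

Lemma expectD p n F G :
  expect p n (fun w => F w + G w) = expect p n F + expect p n G.
Proof. by elim: n F G => //= n ih F G; rewrite !ih; ring. Qed.

Lemma expectZ p n (r : R) F :
  expect p n (fun w => r * F w) = r * expect p n F.
Proof. by elim: n F => //= n ih F; rewrite !ih; ring. Qed.

Lemma expect_cat p m n F : expect p (m + n) F =
  expect p m (fun u => expect p n (fun v => F (u ++ v))).
Proof. by elim: m F => //= m ih F; rewrite !ih. Qed.

Lemma expect_continuous n F : continuous (fun p => expect p n F).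
Proof.
elim: n F => [|n ih] F p /=; first exact: cvg_cst.
apply: cvgD; apply: cvgM; [exact: cvg_id|exact: ih| |exact: ih].
by apply: cvgB; [exact: cvg_cst|exact: cvg_id].
Qed.

Lemma words_bounded n F : exists2 B : R, 1 <= B &
  forall w, size w = n -> `|F w| <= B.
Proof.
elim: n F => [|n ih] F.
  by exists (1 + `|F [::]|) => [|[]// _]; rewrite ?lerDl ?lerDr.
have [B1 h1 hB1] := ih (fun w => F (true :: w)).
have [B2 h2 hB2] := ih (fun w => F (false :: w)).
exists (Num.max B1 B2) => [|[//|[] w] /= [hw]]; rewrite le_max ?h1//.
- by rewrite hB1.
- by rewrite hB2// orbT.
Qed.

Section Unit.
Context (p : R) (p01 : 0 <= p <= 1).

Lemma expect_le n F G : (forall w, size w = n -> F w <= G w) ->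
  expect p n F <= expect p n G.
Proof.
have [p0 p1] := andP p01.
elim: n F G => [|n ih] F G h /=; first exact: h.
by apply: lerD; apply: ler_wpM2l; rewrite ?subr_ge0//;
  apply: ih => w hw; apply: h; rewrite /= hw.
Qed.

Lemma expect_ge0 n F : (forall w, 0 <= F w) -> 0 <= expect p n F.
Proof.
move=> h; rewrite -[leLHS](expect_cst p n).
by apply: expect_le => w _; exact: h.
Qed.

Definition subadditive F := forall u v, F (u ++ v) <= F u + F v.

Lemma expect_subadditive F j k : subadditive F ->
  expect p (j.+1 * k) F <= j.+1%:R * expect p k F.
Proof.
move=> hF; elim: j => [|j ih]; first by rewrite mul1n mul1r.
rewrite mulSn expect_cat.
apply: (@le_trans _ _ (expect p k (fun u => F u + expect p (j.+1 * k) F))).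
  apply: expect_le => u _.
  rewrite -[X in X + _](expect_cst p (j.+1 * k)) -expectD.
  by apply: expect_le => v _; exact: hF.
by rewrite expectD expect_cst -(natr1 j.+1) mulrDl mul1r addrC lerD2r.
Qed.

(** Writing [n = q k + r], submultiplicativity reduces [c n] to [c k ^ q * c r]; the
constant absorbs the finitely many remainders [r < k]. *)
Lemma submultiplicative_growth (c : nat -> R) (theta : R) k :
  0 < theta -> (0 < k)%N -> (forall n, 0 <= c n) ->
  (forall m n, c (m + n)%N <= c m * c n) -> c k <= theta ^+ k ->
  exists2 C : R, 0 <= C & forall n, c n <= C * theta ^+ n.
Proof.
move=> t0 k0 c0 csub ck.
have hr r : 0 <= c r / theta ^+ r by rewrite divr_ge0// exprn_ge0// ltW.
exists (\sum_(r < k) c r / theta ^+ r) => [|n].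
  by apply: sumr_ge0 => r _; exact: hr.
have h q r : c (q * k + r)%N <= theta ^+ (q * k) * c r.
  elim: q => [|q ih]; first by rewrite mul0n add0n mul1r.
  rewrite mulSn -addnA exprD (le_trans (csub _ _))// -mulrA ler_pM//.
rewrite {1}(divn_eq n k) (le_trans (h _ _))//.
rewrite [in leRHS](divn_eq n k) exprD mulrCA.
rewrite ler_pM2l ?exprn_gt0// -ler_pdivrMr ?exprn_gt0//.
have hk : (n %% k < k)%N by rewrite ltn_pmod.
by rewrite (bigD1 (Ordinal hk))//= lerDl sumr_ge0.
Qed.

(** From [expR (- y) >= 1 - y], hence [expR y <= (1 - y)^-1]. *)
Lemma expR_le_quadratic (y : R) : y <= 2^-1 -> expR y <= 1 + y + 2 * y ^+ 2.
Proof.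
move=> hy; have h1 : 0 < 1 - y by lra.
have h2 : expR y <= (1 - y)^-1.
  rewrite -[expR y]invrK lef_pV2 ?posrE ?invr_gt0 ?expR_gt0//.
  by rewrite -expRN expR_ge1Dx.
apply: (le_trans h2); rewrite -[_^-1]mul1r ler_pdivrMr//.
rewrite -subr_ge0 (_ : _ - _ = y ^+ 2 * (1 - 2 * y)); last by ring.
by rewrite mulr_ge0 ?sqr_ge0//; lra.
Qed.

(** Chernoff bound.  The exponential moments of a subadditive function are
submultiplicative in the length, so a moment estimate at the single length [k]
controls all lengths; at length [k] the function is bounded, and a small
exponent [t] gives [1 + t E + O(t ^ 2)]. *)
Lemma subadditive_tail F k (e : R) : subadditive F -> (0 < k)%N -> 0 < e ->
  exists C rho : R, [/\ 0 <= C, 0 < rho < 1 & forall n,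
    expect p n (fun w => (n%:R * (expect p k F / k%:R + e) <= F w)%R%:R)
      <= C * rho ^+ n].
Proof.
move=> hF k0 e0; have [B B1 hB] := words_bounded k F.
have B0 : 0 < B by exact: lt_le_trans B1.
have kR : 0 < k%:R :> R by rewrite ltr0n.
set E := expect p k F; set m := E / k%:R.
(* The first bound puts [t * F] in the range of [expR_le_quadratic]; the second *)
(* keeps the quadratic term below half of the margin [t * k * e]. *)
pose t := Num.min ((2 * B)^-1) (k%:R * e / (4 * B ^+ 2)).
have B4 : 0 < 4 * B ^+ 2 by rewrite mulr_gt0// exprn_gt0.
have t0 : 0 < t.
  by rewrite lt_min invr_gt0 mulr_gt0//= divr_gt0// mulr_gt0.
have tB : t * B <= 2^-1.
  have -> : 2^-1 = (2 * B)^-1 * B by field; rewrite gt_eqF.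
  by rewrite ler_pM2r// ge_min lexx.
have tB2 : t * (4 * B ^+ 2) <= k%:R * e.
  by rewrite -ler_pdivlMr// ge_min lexx orbT.
pose theta := expR (t * (m + e / 2)).
pose c n := expect p n (fun w => expR (t * F w)).
have c0 n : 0 <= c n by apply: expect_ge0 => w; exact: expR_ge0.
have csub n1 n2 : c (n1 + n2)%N <= c n1 * c n2.
  rewrite /c expect_cat mulrC -expectZ.
  apply: expect_le => u _; rewrite mulrC -expectZ.
  apply: expect_le => v _; rewrite -expRD ler_expR -mulrDr.
  by rewrite ler_pM2l.
have ck : c k <= theta ^+ k.
  apply: (@le_trans _ _ (expect p k
    (fun w => (1 + 2 * (t * B) ^+ 2) + t * F w))).
    apply: expect_le => w hw.
    have := hB w hw; rewrite ler_norml => /andP[f1 f2].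
    apply: (le_trans (expR_le_quadratic _)).
      by apply: le_trans tB; rewrite ler_pM2l.
    rewrite -[leRHS]addrAC lerD2l !exprMn ler_pM2l// ler_pM2l ?exprn_gt0//.
    by rewrite -ler_sqrt ?sqr_ge0// !sqrtr_sqr (gtr0_norm B0) hB.
  rewrite expectD expect_cst expectZ -/E.
  rewrite /theta -expRM_natr; apply: le_trans (expR_ge1Dx _).
  rewrite -addrA lerD2l /m.
  have -> : t * (E / k%:R + e / 2) * k%:R = t * E + t * (k%:R * e) / 2.
    by field; rewrite gt_eqF.
  rewrite addrC lerD2l -subr_ge0.
  have -> : t * (k%:R * e) / 2 - 2 * (t * B) ^+ 2 =
    t / 2 * (k%:R * e - t * (4 * B ^+ 2)) by field.
  by rewrite mulr_ge0 ?subr_ge0// ltW// divr_gt0.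
have [C C0 hC] := submultiplicative_growth (expR_gt0 _) k0 c0 csub ck.
exists C, (expR (- (t * (e / 2)))); split => //.
  by rewrite expR_gt0 expR_lt1 oppr_lt0 mulr_gt0// divr_gt0.
move=> n; set a := n%:R * (m + e).
apply: (@le_trans _ _ (expect p n
  (fun w => expR (- (t * a)) * expR (t * F w)))).
  apply: expect_le => w _; rewrite -expRD.
  case: (leP a) => h; last exact: expR_ge0.
  rewrite (le_trans _ (expR_ge1Dx _))// lerDl addrC subr_ge0.
  by rewrite ler_pM2l.
rewrite expectZ -/(c n) mulrC.
apply: (@le_trans _ _ (C * theta ^+ n * expR (- (t * a)))).
  by rewrite ler_pM2r ?expR_gt0.
rewrite -mulrA ler_wpM2l// -!expRM_natr -expRD ler_expR /a -subr_ge0.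
by rewrite le_eqVlt; apply/orP; left; apply/eqP; field.
Qed.

End Unit.

End Expectation.

(** * The Lyapunov function *)

Section LogGrowth.
Context {R : realType}.

(** From [ln (d y) <= d y] with [d] proportional to [e]. *)
Lemma ln_eventually_small (K e : R) : 0 < e ->
  \forall n \near \oo, K + 2 * ln n.+2%:R <= e * n%:R.
Proof.
move=> e0; pose d := e / 4; have d0 : 0 < d by rewrite divr_gt0.
near=> n.
have n2 : 0 < n.+2%:R :> R by [].
have h : ln n.+2%:R <= d * n.+2%:R - ln d :> R.
  by rewrite lerBrDl -lnM ?posrE// ltW// ln_sublinear// mulr_gt0.
have hn : (K + 4 * d - 2 * ln d) / (2 * d) <= n%:R.
  by near: n; exact: nbhs_infty_ger.
rewrite ler_pdivrMr ?mulr_gt0// in hn.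
have -> : e = 4 * d by rewrite /d; field.
rewrite -(natr1 n.+1) -(natr1 n) in h *.
lra.
Unshelve. all: by end_near. Qed.

Lemma cvg_le_ln_div (K : R) : (K + 2 * ln n.+2%:R) / n%:R @[n --> \oo] --> 0.
Proof.
have h0 : \forall n \near \oo, 0 <= (K + 2 * ln n.+2%:R) / n%:R.
  near=> n; rewrite divr_ge0//.
  have : expR (- K / 2) <= n%:R by near: n; exact: nbhs_infty_ger.
  move=> h; have : - K / 2 <= ln n.+2%:R.
    rewrite -[leLHS]expRK ler_ln ?posrE ?expR_gt0//.
    by rewrite (le_trans h)// ler_nat -addn2 leq_addr.
  lra.
apply/cvgrPdist_le => e e0; near=> n.
rewrite sub0r normrN ger0_norm; last by near: n.
have n0 : 0 < n%:R :> R by rewrite ltr0n; near: n; exact: nbhs_infty_gt.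
by rewrite ler_pdivrMr//; near: n; exact: ln_eventually_small.
Unshelve. all: by end_near. Qed.

End LogGrowth.

Section Lyapunov.
Context {R : realType}.
Implicit Types (p : R) (u v w : seq bool).

Definition ln_corner w : R := ln (corner (wordmx w)).

Definition ln_mass w : R := ln (mass (wordmx w)).

Let corner_gt0 w : 0 < corner (wordmx w : 'M[R]_2).
Proof. exact: lt_le_trans (corner_ge1 w). Qed.

Let mass_gt0 w : 0 < mass (wordmx w : 'M[R]_2).
Proof. exact: lt_le_trans (mass_ge1 w). Qed.

Lemma ln_corner_ge0 w : 0 <= ln_corner w.
Proof. by rewrite ln_ge0// corner_ge1. Qed.

Lemma ln_mass_subadditive : subadditive ln_mass.
Proof.
move=> u v; rewrite /ln_mass -lnM ?posrE// ler_ln ?posrE ?mulr_gt0//.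
by rewrite wordmx_cat mass_submult//; exact: nonneg_wordmx.
Qed.

Lemma ln_corner_superadditive : subadditive (fun w => - ln_corner w).
Proof.
move=> u v; rewrite /ln_corner -opprD lerN2 -lnM ?posrE//.
rewrite ler_ln ?posrE ?mulr_gt0//.
by rewrite wordmx_cat corner_supermult//; exact: nonneg_wordmx.
Qed.

Lemma ln_corner_le_mass w : ln_corner w <= ln_mass w.
Proof.
by rewrite ler_ln ?posrE//; apply: corner_le_mass; exact: nonneg_wordmx.
Qed.

Lemma ln_mass_le_corner w : ln_mass w <= ln_corner w + 2 * ln (size w).+2%:R.
Proof.
have h : 0 < (size w).+2%:R :> R by [].
rewrite mulr_natl -lnXn// addrC -lnM ?posrE ?exprn_gt0//.
by rewrite ler_ln ?posrE ?mulr_gt0 ?exprn_gt0// mass_le_corner.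
Qed.

(** For [p] in [[0, 1]] the supremum is also the limit of the means, by
superadditivity, and it is the Lyapunov exponent for [p] in (0, 1). *)
Definition lyap p : R :=
  sup [set expect p k ln_corner / k%:R | k in [set k | (0 < k)%N]].

Section Unit.
Context (p : R) (p01 : 0 <= p <= 1).

(** Compare both means with the means at the common length [j * k]. *)
Lemma mean_corner_le_mean_mass j k : (0 < j)%N -> (0 < k)%N ->
  expect p j ln_corner / j%:R <= expect p k ln_mass / k%:R.
Proof.
case: j => // j; case: k => // k _ _.
rewrite ler_pdivrMr// mulrAC ler_pdivlMr//.
apply: (@le_trans _ _ (expect p (j.+1 * k.+1) ln_mass)); last first.
  by rewrite mulrC expect_subadditive//; exact: ln_mass_subadditive.
apply: (@le_trans _ _ (expect p (j.+1 * k.+1) ln_corner)); last first.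
  by apply: expect_le => // w _; exact: ln_corner_le_mass.
have := expect_subadditive p01 k j.+1 ln_corner_superadditive.
have h n : expect p n (fun w => - ln_corner w) = - expect p n ln_corner.
  by rewrite -mulN1r -expectZ; apply: eq_expect => w _; rewrite mulN1r.
by rewrite !h mulrN lerN2 mulnC mulrC.
Qed.

Lemma mean_corner_le_lyap k : (0 < k)%N ->
  expect p k ln_corner / k%:R <= lyap p.
Proof.
move=> k0; apply: ub_le_sup; last by exists k.
by exists (expect p 1 ln_mass / 1%:R) => _ [j j0 <-];
  exact: mean_corner_le_mean_mass.
Qed.

Lemma lyap_le_mean_mass k : (0 < k)%N ->
  lyap p <= expect p k ln_mass / k%:R.
Proof.
move=> k0; apply: ge_sup => [|_ [j j0 <-]]; last first.
  exact: mean_corner_le_mean_mass.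
by exists (expect p 1 ln_corner / 1%:R), 1.
Qed.

Lemma mean_mass_le_mean_corner k : (0 < k)%N -> expect p k ln_mass / k%:R <=
  expect p k ln_corner / k%:R + 2 * ln k.+2%:R / k%:R.
Proof.
move=> k0; rewrite -mulrDl ler_pM2r ?invr_gt0 ?ltr0n//.
rewrite -[X in _ + X](expect_cst p k) -expectD.
by apply: expect_le => // w <-; exact: ln_mass_le_corner.
Qed.

Lemma lyap_dist k : (0 < k)%N ->
  `|lyap p - expect p k ln_corner / k%:R| <= 2 * ln k.+2%:R / k%:R.
Proof.
move=> k0; rewrite ger0_norm ?subr_ge0 ?mean_corner_le_lyap//.
by rewrite lerBlDl (le_trans (lyap_le_mean_mass k0))// mean_mass_le_mean_corner.
Qed.

End Unit.

(** A uniform limit of polynomials on [[0, 1]].  The argument is clamped to [[0, 1]]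
to get a function that is continuous on the whole line. *)
Lemma lyap_continuous : continuous (fun p => lyap (Num.max 0 (Num.min p 1))).
Proof.
pose q (x : R) := Num.max 0 (Num.min x 1).
have q01 x : 0 <= q x <= 1.
  by rewrite /q le_max lexx ge_max ler01 ge_min lexx orbT.
have qc : continuous q.
  move=> x; have h1 : {for x, continuous (id \min cst 1 : R -> R^o)}.
    by apply: continuous_min; [exact: cvg_id|exact: cst_continuous].
  have h2 : {for x, continuous (cst 0 \max (id \min cst 1) : R -> R^o)}.
    by apply: continuous_max => //; exact: cst_continuous.
  exact: h2.
move=> x; apply/cvgrPdist_le => e e0.
have [k k0 hk] : exists2 k : nat, (0 < k)%N & 2 * ln k.+2%:R / k%:R <= e / 3.
  have e3 : 0 < e / 3 by rewrite divr_gt0.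
  have := ln_eventually_small 0 e3 => -[N _ hN].
  exists N.+1 => //; have /hN : (N <= N.+1)%N by [].
  by rewrite /= add0r ler_pdivrMr.
have hc : {for x, continuous (fun y => expect (q y) k ln_corner / k%:R)}.
  apply: cvgM; last exact: cvg_cst.
  apply: (@continuous_comp _ _ _ q (fun r => expect r k ln_corner)).
    exact: qc.
  exact: expect_continuous.
near=> y.
have hxy : `|expect (q x) k ln_corner / k%:R - expect (q y) k ln_corner / k%:R|
    <= e / 3.
  by near: y; move/cvgrPdist_le : hc; apply; rewrite divr_gt0.
have := lyap_dist (q01 x) k0; have := lyap_dist (q01 y) k0.
rewrite -/(q x) -/(q y).
move: hxy; rewrite !ler_norml => /andP[a1 a2] /andP[b1 b2] /andP[c1 c2].
by apply/andP; split; lra.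
Unshelve. all: by end_near. Qed.

Lemma expect0 n (F : seq bool -> R) : expect 0 n F = F (nseq n false).
Proof. by elim: n F => //= n ih F; rewrite !ih; ring. Qed.

Lemma expect1 n (F : seq bool -> R) : expect 1 n F = F (nseq n true).
Proof. by elim: n F => //= n ih F; rewrite !ih; ring. Qed.

Let lyap_eq0 p : (forall k, expect p k ln_corner = 0) -> lyap p = 0.
Proof.
move=> h; rewrite /lyap -[RHS](sup1 0); congr sup; apply/seteqP; split => x /=.
  by move=> [k _ <-]; rewrite h mul0r.
by move=> ->; exists 1 => //; rewrite h mul0r.
Qed.

Lemma lyap0 : lyap 0 = 0.
Proof. by apply: lyap_eq0 => k; rewrite expect0 /ln_corner corner_nseq ln1. Qed.

Lemma lyap1 : lyap 1 = 0.
Proof. by apply: lyap_eq0 => k; rewrite expect1 /ln_corner corner_nseq ln1. Qed.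

Lemma lyap_gt0 p : 0 < p < 1 -> 0 < lyap p.
Proof.
move=> /andP[p0 p1]; have p01 : 0 <= p <= 1 by rewrite !ltW.
apply: lt_le_trans (mean_corner_le_lyap p01 (isT : (0 < 2)%N)).
rewrite divr_gt0//=.
have h : 0 < ln_corner [:: true; false].
  rewrite ln_gt0// !wordmx_cons wordmx_nil mulr1 /corner mulmx2E /=.
  rewrite !mat_aE !mat_bE.
  lra.
apply: (@lt_le_trans _ _ (p * ((1 - p) * ln_corner [:: true; false]))).
  by rewrite !mulr_gt0// subr_gt0.
by rewrite mulrDr -!addrA addrCA lerDl !addr_ge0 ?mulr_ge0 ?subr_ge0 ?addr_ge0
  ?mulr_ge0 ?ln_corner_ge0 ?subr_ge0// ltW.
Qed.

Definition ln_gauge w : R := ln (gauge (wordmx w)).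

Let gauge_gt0 w : 0 < gauge (wordmx w : 'M[R]_2).
Proof.
apply: lt_le_trans (mass_le_gauge _); first exact: mass_gt0.
exact: nonneg_wordmx.
Qed.

(** Upper bound for the logarithmic growth of the extremal norm over a block of
three letters, with the gain provided by the block [aaa]. *)
Definition block_bound u : R :=
  3 * ln golden +
  (u == [:: true; true; true])%:R * (ln (golden + 2) - 3 * ln golden).

Lemma ln_gauge_block u w : size u = 3%N ->
  ln_gauge (u ++ w) <= block_bound u + ln_gauge w.
Proof.
have g0 := @golden_gt0 R.
move=> hu; rewrite /block_bound /ln_gauge wordmx_cat.
have hw : nonneg (wordmx w : 'M[R]_2) by exact: nonneg_wordmx.
have [->|_] := eqVneq u _.
  rewrite mul1r addrCA subrr addr0 -lnM ?posrE ?addr_gt0//.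
  rewrite ler_ln ?posrE ?mulr_gt0 ?addr_gt0// -?wordmx_cat//.
  by rewrite wordmx_cat gauge_aaa.
rewrite mul0r addr0 mulr_natl -lnXn// -lnM ?posrE ?exprn_gt0//.
rewrite ler_ln ?posrE ?mulr_gt0 ?exprn_gt0// -?wordmx_cat// -hu.
elim: u {hu} => [|c u ih]; first by rewrite mul1r.
rewrite /= wordmx_cons (le_trans (gauge_letter _ _))//.
  exact: nonneg_wordmx.
by rewrite exprS -mulrA ler_pM2l.
Qed.

Lemma golden_cube_gt : golden + 2 < golden ^+ 3 :> R.
Proof.
have p2 := @golden_sqr R; have p1 := @golden_gt1 R.
rewrite exprS p2 mulrDr -expr2 p2 mulr1; lra.
Qed.

(** Cutting a word of length [3 m] into blocks, each block [aaa] saves a fixed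
amount [d], and the proportion of such blocks is [p ^ 3] on average. *)
Lemma lyap_lt_ln_golden p : 0 < p < 1 -> lyap p < ln golden.
Proof.
move=> /andP[p0 p1]; have p01 : 0 <= p <= 1 by rewrite !ltW.
have g0 := @golden_gt0 R.
pose d : R := 3 * ln golden - ln (golden + 2).
have d0 : 0 < d.
  rewrite subr_gt0 mulr_natl -lnXn// ltr_ln ?posrE ?exprn_gt0 ?addr_gt0//.
  exact: golden_cube_gt.
have hblock : expect p 3 block_bound = 3 * ln golden - p ^+ 3 * d.
  by rewrite /= /block_bound /= /d; ring.
have hm m : expect p (m * 3) ln_gauge <=
    m%:R * (3 * ln golden - p ^+ 3 * d) + ln_gauge [::].
  elim: m => [|m ih]; first by rewrite mul0n mul0r add0r.
  rewrite mulSn expect_cat.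
  apply: (@le_trans _ _ (expect p 3
    (fun u => block_bound u + expect p (m * 3) ln_gauge))).
    apply: expect_le => // u hu.
    rewrite -[X in X + _](expect_cst p (m * 3)) -expectD.
    by apply: expect_le => // v _; exact: ln_gauge_block.
  rewrite expectD expect_cst hblock -(natr1 m).
  by set K := _ - _ in ih *; lra.
set r := p ^+ 3 * d; have r0 : 0 < r by rewrite mulr_gt0// exprn_gt0.
have [m hm1] : exists m : nat, ln_gauge [::] < m.+1%:R * r.
  exists (Num.truncn (ln_gauge [::] / r)).
  by rewrite -ltr_pdivrMr// truncnS_gt.
apply: le_lt_trans (lyap_le_mean_mass p01 (isT : (0 < m.+1 * 3)%N)) _.
rewrite ltr_pdivrMr//; apply: (@le_lt_trans _ _ (expect p (m.+1 * 3) ln_gauge)).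
  apply: expect_le => // w _; rewrite ler_ln ?posrE//.
  by apply: mass_le_gauge; exact: nonneg_wordmx.
apply: (le_lt_trans (hm _)); rewrite natrM -/r.
set M := m.+1%:R in hm1 *.
lra.
Qed.

End Lyapunov.

(** * Bernoulli digit processes *)

Section BernoulliDigits.
Context {R : realType} d (T : measurableType d) (P : probability T R).
Context (p : R) (p01 : 0 <= p <= 1) (D : nat -> T -> bool).
Implicit Types (w : seq bool) (m n : nat).

Definition weight (q : R) w : R := \prod_(c <- w) (if c then q else 1 - q).

Definition digits m n (x : T) : seq bool := [seq D i x | i <- iota m n].

Lemma size_digits m n x : size (digits m n x) = n.
Proof. by rewrite size_map size_iota. Qed.

Definition cylinder w : set T := [set x | digits 0 (size w) x = w].

(** The digits are independent with law Bernoulli([p]), expressed through the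
measure of the cylinders. *)
Definition bernoulli_digits :=
  forall w, measurable (cylinder w) /\ P (cylinder w) = (weight p w)%:E.

Context (hD : bernoulli_digits).

(** The prefix [w] makes the induction on [n] go through: splitting along the next
digit lengthens [w] and shortens the constrained part. *)
Lemma measure_cylinder_digits w n (Q : pred (seq bool)) :
  let A := cylinder w `&` [set x | Q (digits (size w) n x)] in
  measurable A /\
  P A = (weight p w * expect p n (fun v => (Q v)%:R))%:E.
Proof.
elim: n w Q => [|n ih] w Q /=.
  have -> : [set x | Q (digits (size w) 0 x)] = if Q [::] then setT else set0.
    by rewrite /digits /=; case: (Q [::]); apply/seteqP; split.
  case: (Q [::]); first by rewrite setIT mulr1; exact: hD.
  by rewrite setI0 measure0 mulr0.
have cylS c : cylinder (rcons w c) = cylinder w `&` [set x | D (size w) x = c].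
  rewrite /cylinder /digits size_rcons -(addn1 (size w)) iotaD add0n /=.
  apply/seteqP; split => x /=; rewrite map_cat cats1.
    by move=> /rcons_inj[-> ->].
  by move=> [-> ->].
pose S c := cylinder (rcons w c) `&`
  [set x | Q (c :: digits (size (rcons w c)) n x)].
have -> : cylinder w `&` [set x | Q (digits (size w) n.+1 x)] =
    S true `|` S false.
  rewrite /S !cylS !size_rcons; apply/seteqP; split => x /=.
    by rewrite /digits /=; case: (D _ x) => -[h1 h2]; [left|right].
  by move=> [] [[h1 h2] h3]; split => //; move: h3; rewrite /digits /= h2.
have [m1 P1] := ih (rcons w true) (fun v => Q (true :: v)).
have [m2 P2] := ih (rcons w false) (fun v => Q (false :: v)).
split; first exact: measurableU.
have -> : P (S true `|` S false) = (P (S true) + P (S false))%E.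
  apply: measureU => //.
  by rewrite /S !cylS; apply/seteqP; split => x //= [[[_ ->] _] [[_]]].
rewrite /S P1 P2 -EFinD /weight -!cats1 !big_cat !big_seq1 /=.
by congr (_%:E); ring.
Qed.

Lemma measure_digits n (Q : pred (seq bool)) :
  let A := [set x | Q (digits 0 n x)] in
  measurable A /\ P A = (expect p n (fun v => (Q v)%:R))%:E.
Proof.
have := measure_cylinder_digits [::] n Q.
rewrite /= (_ : cylinder [::] = setT) ?setTI; last first.
  by apply/seteqP; split.
by rewrite /weight big_nil mul1r.
Qed.

(** Borel-Cantelli: the tails of [subadditive_tail] are summable. *)
Lemma subadditive_digits_ae (F : seq bool -> R) (l e : R) :
  subadditive F ->
  (forall e, 0 < e -> exists2 k, (0 < k)%N & expect p k F / k%:R <= l + e) ->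
  0 < e ->
  {ae P, forall x, \forall n \near \oo, F (digits 0 n x) < n%:R * (l + e)}.
Proof.
move=> hF hl e0; have e20 : 0 < e / 2 by rewrite divr_gt0.
have [k k0 hk] := hl _ e20.
have [C [rho [C0 /andP[r0 r1] htail]]] := subadditive_tail p01 hF k0 e20.
pose Q n w := n%:R * (expect p k F / k%:R + e / 2) <= F w.
pose A n := [set x | Q n (digits 0 n x)].
have mA n : measurable (A n) by have [] := measure_digits n (Q n).
have PA n : P (A n) = (expect p n (fun v => (Q n v)%:R))%:E.
  by have [] := measure_digits n (Q n).
have hsum : (\sum_(n <oo) P (A n) < +oo)%E.
  apply: (@le_lt_trans _ _ (C / (1 - rho))%:E); last exact: ltry.
  apply: lime_le; first by apply: is_cvg_nneseries => n _ _; exact: measure_ge0.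
  apply: nearW => n.
  apply: (@le_trans _ _ (\sum_(0 <= i < n) (C * rho ^+ i)%:E)%E).
    by apply: lee_sum => i _; rewrite PA lee_fin; exact: htail.
  rewrite sumEFin lee_fin.
  rewrite -[leLHS]/(series (geometric C rho) n) geometric_seriesE ?lt_eqF//=.
  rewrite ler_pM2r ?invr_gt0 ?subr_gt0// ler_piMr//.
  by rewrite gerBl exprn_ge0// ltW.
have h0 := lim_sup_set_cvg0 mA hsum.
exists (lim_sup_set A); split => //.
  apply: bigcap_measurable => // n _.
  by apply: bigcup_measurable => j _; exact: mA.
move=> x /= hx; apply: contrapT => hx'; apply: hx.
have /existsNP[N hN] : ~ forall N, (\bigcup_(j >= N) A j) x.
  by move=> h; apply: hx' => n _; exact: h.
exists N => // n /= Nn; rewrite ltNge; apply/negP => hn; apply: hN.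
exists n => //=; rewrite /A /= /Q (le_trans _ hn)// ler_wpM2l//.
by move: hk; lra.
Qed.

End BernoulliDigits.

(** * Products of independent matrices *)

Section BernoulliProducts.
Context {R : realType}.

Lemma mat_a_neq_b : mat_a R != mat_b R.
Proof.
apply/eqP => /(congr1 (fun A : 'M[R]_2 => A 0 1)).
by rewrite /= mat_aE mat_bE => /eqP; rewrite oner_eq0.
Qed.

Lemma measurable_matrix1 (A : 'M[R]_2) : measurable ([set A] : set (borelM2 R)).
Proof.
rewrite -[X in measurable X]setCK; apply: measurableC.
apply: sub_sigma_algebra; apply: closed_openC.
exact: accessible_closed_set1 (hausdorff_accessible (@norm_hausdorff _ _)) _.
Qed.

(** The digit of a matrix only tests whether it is [a].  The complement stands for
[b], which is the same event up to a null set. *)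
Definition letter_set (c : bool) : set (borelM2 R) :=
  if c then [set mat_a R] else ~` [set mat_a R].

Lemma measurable_letter_set c : measurable (letter_set c).
Proof.
by case: c; rewrite /letter_set; [|apply: measurableC];
  exact: measurable_matrix1.
Qed.

Lemma mu_letter_set (p : R) (p01 : 0 < p < 1) c :
  mu_ab p01 (letter_set c) = (if c then p else 1 - p)%:E.
Proof.
rewrite /mu_ab /= /two_point !diracE; case: c; rewrite /letter_set.
  rewrite mem_set//= memNset/= ?mule1 ?mule0 ?adde0//.
  by move=> h; have /eqP := mat_a_neq_b; rewrite h.
rewrite memNset/=; last exact.
rewrite mem_set/= ?mule1 ?mule0 ?add0e//.
by move=> h; have /eqP := mat_a_neq_b; rewrite h.
Qed.

Section Iid.
Context (p : R) (p01 : 0 < p < 1) d (T : measurableType d) (P : probability T R)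
  (g : nat -> {RV P >-> borelM2 R}) (g_iid : iid g (mu_ab p01)).

Definition a_digit (i : nat) (x : T) : bool := (g i x : 'M[R]_2) == mat_a R.

Lemma a_digitE i x c : (a_digit i x = c) <-> letter_set c (g i x).
Proof.
rewrite /a_digit /letter_set; split => [<-|].
  by have [->|/eqP] := eqVneq (g i x : 'M[R]_2) (mat_a R).
by case: c => /= [->|/eqP/negbTE//]; rewrite eqxx.
Qed.

Lemma iid_bernoulli_digits : bernoulli_digits P p a_digit.
Proof.
move=> w; pose J := [fset i | i in iota 0 (size w)]%fset.
have inJ i : (i \in J) = (i < size w)%N by rewrite /J !inE /= mem_iota.
pose A i := letter_set (nth false w i).
have mA i : measurable (A i) by exact: measurable_letter_set.
have -> : cylinder a_digit w = \bigcap_(i in [set` J]) (g i @^-1` A i).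
  apply/seteqP; split => x /=.
    move=> hx i /=; rewrite inJ => hi.
    apply/a_digitE; rewrite -[in RHS]hx /digits (nth_map 0%N) ?size_iota//.
    by rewrite nth_iota.
  move=> hx; rewrite /cylinder /=; apply: (@eq_from_nth _ false);
    rewrite size_digits// => i hi.
  rewrite /digits (nth_map 0%N) ?size_iota// nth_iota// add0n.
  by apply/a_digitE; apply: hx; rewrite /= inJ.
split.
  apply: bigcap_measurableType => i _.
  by rewrite -[X in measurable X]setTI; exact: measurable_funP.
rewrite (proj2 g_iid)//.
have -> : (\prod_(i <- J) P (g i @^-1` A i) =
   \prod_(i <- iota 0 (size w)) P (g i @^-1` A i))%E.
  apply: perm_big; apply: uniq_perm; [exact: fset_uniq|exact: iota_uniq|].
  by move=> i; rewrite inJ mem_iota.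
rewrite /weight -prodEFin (big_nth false) -{1}(subn0 (size w)).
rewrite -[iota _ _]/(index_iota 0 _).
apply: eq_big_nat => i _.
rewrite -mu_letter_set; exact: (proj1 g_iid).
Qed.

Lemma iid_letters_ae :
  {ae P, forall x i, (g i x : 'M[R]_2) = letter (a_digit i x)}.
Proof.
apply: ae_foralln => i.
pose N : set (borelM2 R) := ~` [set mat_a R] `&` ~` [set mat_b R].
have mN : measurable N.
  by apply: measurableI; apply: measurableC; exact: measurable_matrix1.
exists (g i @^-1` N); split.
- by rewrite -[X in measurable X]setTI; exact: measurable_funP.
- transitivity (mu_ab p01 N); first exact: (proj1 g_iid i N mN).
  rewrite /mu_ab /= /two_point !diracE !memNset ?mule0 ?adde0//.
  + by move=> [_]; exact.
  + by move=> [+ _]; exact.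
- move=> x /= hx; split => h; apply: hx; rewrite /a_digit /letter.
    by rewrite h eqxx.
  by case: eqP => [->|_].
Qed.

Lemma prod_letters x n : (forall i, (g i x : 'M[R]_2) = letter (a_digit i x)) ->
  \prod_(i < n) (g i x : 'M[R]_2) = wordmx (digits a_digit 0 n x).
Proof.
move=> h; rewrite /wordmx /digits big_map -[iota 0 n](_ : index_iota 0 n = _).
  by rewrite big_mkord; apply: eq_bigr => i _; rewrite h.
by rewrite /index_iota subn0.
Qed.

End Iid.

(** The upper bound comes from the sum of the entries and the lower bound from the
top left entry; both have mean rate [lyap p]. *)
Lemma lyap_is_lyapunov_exponent (p : R) (p01 : 0 < p < 1) :
  is_lyapunov_exponent (mu_ab p01) (lyap p).
Proof.
move=> d T P g g_iid; have hD := iid_bernoulli_digits g_iid.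
have hp : 0 <= p <= 1 by have /andP[? ?] := p01; rewrite !ltW.
pose err n : R := 2 * ln n.+2%:R / n%:R.
have [hup hlo] : (forall e, 0 < e -> exists2 k, (0 < k)%N &
      expect p k ln_mass / k%:R <= lyap p + e) /\
    (forall e, 0 < e -> exists2 k, (0 < k)%N &
      expect p k (fun w => - ln_corner w) / k%:R <= - lyap p + e).
  have hsmall e : 0 < e -> exists2 k, (0 < k)%N & err k <= e.
    move=> e0; have [N _ hN] := ln_eventually_small 0 e0.
    exists N.+1 => //; have /hN : (N <= N.+1)%N by [].
    by rewrite /= add0r /err ler_pdivrMr.
  split => e /hsmall[k k0 hk]; exists k => //.
    rewrite (le_trans (mean_mass_le_mean_corner hp k0))// lerD//.
    exact: mean_corner_le_lyap.
  have -> : expect p k (fun w => - ln_corner w) = - expect p k ln_corner.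
    by rewrite -mulN1r -expectZ; apply: eq_expect => w _; rewrite mulN1r.
  have := lyap_le_mean_mass hp k0; have := mean_mass_le_mean_corner hp k0.
  by rewrite -/(err k) mulNr; lra.
pose D := a_digit g.
have aup : {ae P, forall x m, \forall n \near \oo,
    ln_mass (digits D 0 n x) < n%:R * (lyap p + m.+1%:R^-1)}.
  apply: ae_foralln => m.
  by apply: (subadditive_digits_ae hp hD ln_mass_subadditive hup).
have alo : {ae P, forall x m, \forall n \near \oo,
    - ln_corner (digits D 0 n x) < n%:R * (- lyap p + m.+1%:R^-1)}.
  apply: ae_foralln => m.
  by apply: (subadditive_digits_ae hp hD ln_corner_superadditive hlo).
move: aup alo (iid_letters_ae g_iid); apply: filterS3 => x hx1 hx2 hx3.
apply/cvgrPdist_lt => e e0.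
have [m hm] : exists m : nat, m.+1%:R^-1 < e.
  exists (Num.truncn e^-1); rewrite -[ltRHS]invrK ltf_pV2 ?posrE ?invr_gt0//.
  exact: truncnS_gt.
move: hm (hx1 m) (hx2 m); move: m.+1%:R^-1 => q hq {}hx1 {}hx2.
near=> n.
have n0 : 0 < n%:R :> R by rewrite ltr0n; near: n; exact: nbhs_infty_gt.
have h1 : ln_mass (digits D 0 n x) < n%:R * (lyap p + q) by near: n.
have h2 : - ln_corner (digits D 0 n x) < n%:R * (- lyap p + q) by near: n.
rewrite prod_letters// -/D; set w := digits D 0 n x in h1 h2 *.
have hw : nonneg (wordmx w : 'M[R]_2) by exact: nonneg_wordmx.
have c1 := @corner_ge1 R w.
have c0 : 0 < corner (wordmx w : 'M[R]_2) by exact: lt_le_trans c1.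
have o0 : 0 < op_norm (wordmx w : 'M[R]_2).
  exact: lt_le_trans (corner_le_op_norm hw).
have l1 : ln_corner w <= ln (op_norm (wordmx w)) :> R.
  by rewrite ler_ln ?posrE// corner_le_op_norm.
have l2 : ln (op_norm (wordmx w)) <= ln_mass w :> R.
  rewrite ler_ln ?posrE ?op_norm_le_mass//.
  exact: lt_le_trans (op_norm_le_mass hw).
set L := ln _ in l1 l2 *.
have hme : n%:R * q < n%:R * e by rewrite ltr_pM2l.
rewrite distrC ltr_norml mulrC; apply/andP; split.
  rewrite ltrBrDr ltr_pdivlMr//; lra.
rewrite ltrBlDr ltr_pdivrMr//; lra.
Unshelve. all: by end_near. Qed.


End BernoulliProducts.

(** * A Bernoulli process on the unit interval *)

Section BernoulliProcess.
Context {R : realType} (p : R) (p01 : 0 < p < 1).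
Local Notation P := (@uniform_prob R 0 1 ltr01).
Local Notation T := (measurableTypeR R).

Let p_gt0 : 0 < p. Proof. by case/andP: p01. Qed.

Let q_gt0 : 0 < 1 - p. Proof. by case/andP: p01; rewrite subr_gt0. Qed.

(** Both branches map affinely onto the unit interval, so the uniform law makes the
successive branch choices independent. *)
Definition expanding (x : T) : T := if x < p then x / p else (x - p) / (1 - p).

Definition expansion_digit (i : nat) (x : T) : bool := iter i expanding x < p.

Lemma measurable_expanding : measurable_fun [set: T] expanding.
Proof.
apply: measurable_fun_ifT.
- exact: measurable_fun_ltr.
- exact: measurable_funM.
- by apply: measurable_funM => //; exact: measurable_funB.
Qed.

Lemma measurable_expansion_digit i :
  measurable_fun [set: T] (expansion_digit i).
Proof.
apply: measurable_fun_ltr => //.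
elim: i => [|i ih] /=; first exact: measurable_id.
exact: (measurableT_comp measurable_expanding).
Qed.

Lemma weight_gt0 w : 0 < weight p w.
Proof. by rewrite /weight prodr_gt0// => -[]. Qed.

Lemma digits_cons n x : digits expansion_digit 0 n.+1 x =
  (x < p) :: digits expansion_digit 0 n (expanding x).
Proof.
rewrite /digits /=; congr (_ :: _); rewrite (iotaDl 1) -map_comp.
by apply: eq_map => i /=; rewrite /expansion_digit add1n iterSr.
Qed.

(** The points of [[0, 1]] that follow the branches listed in [w] form an interval
of length [weight p w].  Nothing is claimed at its endpoints, which carry no
mass. *)
Lemma cylinder_interval w : exists l : R, [/\ 0 <= l, l + weight p w <= 1,
  forall x, 0 <= x <= 1 -> l < x < l + weight p w ->
     cylinder expansion_digit w x &
  forall x, 0 <= x <= 1 -> cylinder expansion_digit w x ->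
     l <= x <= l + weight p w].
Proof.
have p0 := p_gt0; have q0 := q_gt0.
elim: w => [|c w [l [l0 l1 h1 h2]]].
  by exists 0; rewrite /weight big_nil add0r.
have w0 := weight_gt0 w.
have cylS x : cylinder expansion_digit (c :: w) x <->
    (x < p) = c /\ cylinder expansion_digit w (expanding x).
  rewrite /cylinder /= digits_cons; split => [[-> ->] //|[-> ->] //].
have hT x : 0 <= x <= 1 -> 0 <= expanding x <= 1.
  move=> /andP[x0 x1]; rewrite /expanding; case: (ltP x p) => hx.
    by rewrite divr_ge0 ?(ltW p0)//= ler_pdivrMr// mul1r ltW.
  apply/andP; split; first by rewrite divr_ge0 ?subr_ge0//; lra.
  by rewrite ler_pdivrMr//; lra.
have -> : weight p (c :: w) = (if c then p else 1 - p) * weight p w.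
  by rewrite /weight big_cons.
set W := weight p w in l1 h1 h2 w0 *.
case: c cylS => cylS.
- exists (p * l); rewrite -mulrDr; split.
  + by rewrite mulr_ge0// ltW.
  + by rewrite (le_trans (y := p * 1)) ?ler_pM2l//; lra.
  + move=> x hx /andP[a b]; apply/cylS.
    have xp : x < p by rewrite (lt_le_trans b)// -[leRHS]mulr1 ler_pM2l.
    split => //; apply: h1; first exact: hT.
    by rewrite /expanding xp ltr_pdivlMr// ltr_pdivrMr// !(mulrC _ p) a b.
  + move=> x hx /cylS[xp /(h2 _ (hT _ hx))].
    by rewrite /expanding xp ler_pdivlMr// ler_pdivrMr// !(mulrC _ p).
- exists (p + (1 - p) * l); rewrite -addrA -mulrDr; split.
  + by rewrite addr_ge0 ?mulr_ge0// ltW.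
  + rewrite (le_trans (y := p + (1 - p) * 1)) ?lerD2l ?ler_pM2l//; lra.
  + move=> x hx /andP[a b]; apply/cylS.
    have xp : (x < p) = false.
      apply/negbTE; rewrite -leNgt (le_trans _ (ltW a))// lerDl.
      by rewrite mulr_ge0// ltW.
    split => //; apply: h1; first exact: hT.
    by rewrite /expanding xp ltr_pdivlMr// ltr_pdivrMr// !(mulrC _ (1 - p))
      ltrBrDl ltrBlDl a b.
  + move=> x hx /cylS[xp /(h2 _ (hT _ hx))].
    by rewrite /expanding xp ler_pdivlMr// ler_pdivrMr// !(mulrC _ (1 - p))
      lerBrDl lerBlDl.
Qed.

Lemma measurable_cylinder w : measurable (cylinder expansion_digit w).
Proof.
have -> : cylinder expansion_digit w =
    \bigcap_(i in [set i | (i < size w)%N])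
      (expansion_digit i @^-1` [set nth false w i]).
  apply/seteqP; split => x /=.
    move=> hx i /= hi; rewrite -[in RHS]hx /digits (nth_map 0%N) ?size_iota//.
    by rewrite nth_iota.
  move=> hx; rewrite /cylinder /=.
  apply: (@eq_from_nth _ false); rewrite size_digits// => i hi.
  rewrite /digits (nth_map 0%N) ?size_iota// nth_iota// add0n.
  exact: hx.
apply: bigcap_measurableType => i _.
rewrite -[X in measurable X]setTI; apply: measurable_expansion_digit => //.
Qed.

Lemma uniform_probE (U : set T) : measurable U ->
  P U = lebesgue_measure (U `&` `[0, 1]).
Proof.
move=> mU; rewrite /uniform_prob integral_uniform_pdf.
rewrite (eq_integral (fun=> 1%:E)); last first.
  move=> x; rewrite inE => -[_]; rewrite /= in_itv /= /uniform_pdf => ->.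
  by rewrite subr0 invr1.
by rewrite integral_cst ?mul1e//; exact: measurableI.
Qed.

Lemma uniform_bernoulli_digits : bernoulli_digits P p expansion_digit.
Proof.
move=> w; split; first exact: measurable_cylinder.
have mc := measurable_cylinder w.
transitivity (lebesgue_measure (cylinder expansion_digit w `&` `[0, 1])).
  exact: uniform_probE.
have [l [l0 l1 h1 h2]] := cylinder_interval w.
have w0 := weight_gt0 w.
have hl : l < l + weight p w by rewrite ltrDl.
have hm (i : interval R) b1 b2 :
    i = Interval (BSide b1 l) (BSide b2 (l + weight p w)) ->
    lebesgue_measure ([set` i] : set R) = (weight p w)%:E.
  move=> ->; rewrite lebesgue_measure_itv /= lte_fin hl.
  by rewrite -EFinB addrAC subrr add0r.
apply/eqP; rewrite eq_le; apply/andP; split.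
  rewrite -(hm _ _ _ (erefl `[l, l + weight p w])).
  apply: le_measure; rewrite ?inE//; first exact: measurableI.
  by move=> x [hx]; rewrite /= !in_itv /= => x01; exact: h2.
rewrite -(hm _ _ _ (erefl `]l, l + weight p w[)).
apply: le_measure; rewrite ?inE//; first exact: measurableI.
move=> x; rewrite /= !in_itv /= => /andP[a b].
have x01 : 0 <= x <= 1 by apply/andP; split; lra.
by split => //; apply: h1 => //; rewrite a b.
Qed.

Lemma expect_prod n (f : nat -> bool -> R) :
  expect p n (fun w => \prod_(0 <= i < n) f i (nth false w i)) =
  \prod_(0 <= i < n) (p * f i true + (1 - p) * f i false).
Proof.
elim: n f => [|n ih] f; first by rewrite /= !big_geq.
rewrite [RHS]big_nat_recl// -(ih (fun i => f i.+1)) mulrDl -!mulrA /=.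
by congr (_ * _ + _ * _); rewrite -expectZ; apply: eq_expect => w _;
  rewrite big_nat_recl.
Qed.

Lemma natr_all (s : seq nat) (Q : pred nat) :
  (all Q s)%:R = \prod_(i <- s) (Q i)%:R :> R.
Proof.
by elim: s => [|i s ih]; rewrite ?big_nil// big_cons -ih /=; case: (Q i);
  rewrite ?mul1r ?mul0r.
Qed.

Definition letter_seq (i : nat) (x : T) : borelM2 R :=
  letter (expansion_digit i x).

Lemma measurable_letter_seq i : measurable_fun [set: T] (letter_seq i).
Proof.
rewrite /letter_seq /letter; apply: measurable_fun_ifT => //.
exact: measurable_expansion_digit.
Qed.

Definition letter_rv i : {RV P >-> borelM2 R} :=
  mfun_Sub (mem_set (@measurable_letter_seq i)).

Let letter_prob (A : set (borelM2 R)) : R :=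
  p * (`[< A (mat_a R) >])%:R + (1 - p) * (`[< A (mat_b R) >])%:R.

(** The event depends on the first [N] digits only, and its indicator is a product
of functions of one digit each, the constant [1] outside [J]. *)
Lemma letter_seq_indep (J : {fset nat}) (A : nat -> set (borelM2 R)) :
  P (\bigcap_(i in [set` J]) (letter_seq i @^-1` A i)) =
  (\prod_(i <- J) letter_prob (A i))%:E.
Proof.
pose N := (\max_(i <- J) i).+1.
have ltN i : i \in J -> (i < N)%N.
  by move=> iJ; rewrite ltnS; exact: (@leq_bigmax_seq _ _ xpredT id).
pose f i c : R := ((i \in J) ==> `[< A i (letter c) >])%:R.
pose Q w := all (fun i => (i \in J) ==> `[< A i (letter (nth false w i)) >])
  (index_iota 0 N).
have nthD i x : (i < N)%N ->
    nth false (digits expansion_digit 0 N x) i = expansion_digit i x.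
  by move=> iN; rewrite /digits (nth_map 0%N) ?size_iota// nth_iota.
have -> : \bigcap_(i in [set` J]) (letter_seq i @^-1` A i) =
    [set x | Q (digits expansion_digit 0 N x)].
  apply/seteqP; split => x /= hx.
    apply/allP => i; rewrite mem_index_iota => /andP[_ iN].
    apply/implyP => iJ; apply/asboolP; rewrite nthD//; exact: (hx i iJ).
  move=> i iJ; have /allP/(_ i) := hx.
  rewrite mem_index_iota ltN// => /(_ isT)/implyP/(_ iJ)/asboolP.
  by rewrite nthD ?ltN.
transitivity ((expect p N (fun v => (Q v)%:R))%:E).
  by have [] := measure_digits uniform_bernoulli_digits N Q.
congr (_%:E).
transitivity (expect p N (fun w => \prod_(0 <= i < N) f i (nth false w i))).
  by apply: eq_expect => w _; rewrite /Q natr_all.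
rewrite expect_prod (bigID (mem J))/= [X in _ * X]big1 ?mulr1; last first.
  by move=> i /negbTE iJ; rewrite /f iJ /= !mulr1 addrC subrK.
rewrite -big_filter; apply: etrans (perm_big (enum_fset J) _) _; last first.
  by apply: eq_big_seq => i iJ; rewrite /f iJ.
apply: uniq_perm; [by rewrite filter_uniq// iota_uniq|exact: fset_uniq|].
move=> i; rewrite mem_filter mem_index_iota /=.
by case: (boolP (i \in J)) => // iJ; rewrite ltN.
Qed.

Lemma letter_seq1 i (A : set (borelM2 R)) :
  P (letter_seq i @^-1` A) = (letter_prob A)%:E.
Proof.
have := letter_seq_indep [fset i]%fset (fun=> A).
rewrite big_seq_fset1 => <-; congr (uniform_prob _ _).
apply/seteqP; split => x /=; first by move=> h j /=; rewrite inE => /eqP ->.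
by move=> h; apply: (h i); rewrite /= inE.
Qed.

Lemma letter_seq_iid : iid letter_rv (mu_ab p01).
Proof.
split => [n A mA|J A mA].
  transitivity (letter_prob A)%:E; first exact: letter_seq1.
  by rewrite /mu_ab /= /two_point !diracE /letter_prob EFinD !EFinM.
transitivity (\prod_(i <- J) letter_prob (A i))%:E.
  exact: letter_seq_indep.
by rewrite -prodEFin; apply: eq_bigr => i _; apply/esym; exact: letter_seq1.
Qed.

End BernoulliProcess.

(** Uniqueness: two candidates are almost sure limits of the same sequence for the
process [letter_rv], and a property that holds almost surely for a probability
holds somewhere. *)
Lemma lyapunov_exponentE {R : realType} (p : R) (p01 : 0 < p < 1) :
  lyapunov_exponent (mu_ab p01) = lyap p.
Proof.
apply: xget_unique; first exact: lyap_is_lyapunov_exponent.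
have P1 : (0 < @uniform_prob R 0 1 ltr01 [set: measurableTypeR R])%E.
  by rewrite probability_setT.
move=> l hl; have h1 := hl _ _ _ _ (letter_seq_iid p01).
have h2 := lyap_is_lyapunov_exponent (letter_seq_iid p01).
have FP := ae_properfilter_algebraOfSetsType P1.
have [x [c1 c2]] := filter_ex (filterI h1 h2).
exact: (cvg_unique (@norm_hausdorff _ _) c1 c2).
Qed.

(** * Hausdorff limits and the joint spectrum *)

Section Hausdorff.
Context {R : realType}.
Implicit Types (A B J : set R) (K : nat -> set R).

Lemma edist_inf_le A (x y r : R) : 0 < r -> A y -> `|x - y| < r ->
  (edist_inf A x <= r%:E)%E.
Proof.
move=> r0 Ay xy; apply: (@le_trans _ _ (edist (x, y))).
  by apply: ereal_inf_lbound; exists y.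
exact: edist_fin.
Qed.

Lemma edist_inf_lt A (x r : R) : (edist_inf A x < r%:E)%E ->
  exists2 y, A y & `|x - y| < r.
Proof. by case/ereal_inf_lt => _ [y Ay <-] /edist_lt_ball; exists y. Qed.

Lemma hausdorff_dist_le A B (r : R) : 0 < r ->
  (forall x, A x -> exists2 y, B y & `|x - y| < r) ->
  (forall y, B y -> exists2 x, A x & `|y - x| < r) ->
  (hausdorff_dist A B <= r%:E)%E.
Proof.
move=> r0 hA hB; rewrite /hausdorff_dist ge_max; apply/andP.
split; apply: ge_ereal_sup => _ [x hx <-].
  by have [y By xy] := hA _ hx; exact: edist_inf_le By xy.
by have [y Ay xy] := hB _ hx; exact: edist_inf_le Ay xy.
Qed.

Lemma hausdorff_dist_ge0 A B : A !=set0 -> (0 <= hausdorff_dist A B)%E.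
Proof.
move=> [x Ax]; rewrite /hausdorff_dist le_max; apply/orP; left.
apply: (@le_trans _ _ (edist_inf B x)); first exact: edist_inf_ge0.
by apply: ereal_sup_ubound; exists x.
Qed.

Lemma hausdorff_dist_lt A B (r : R) : (hausdorff_dist A B < r%:E)%E ->
  (forall x, A x -> exists2 y, B y & `|x - y| < r) /\
  (forall y, B y -> exists2 x, A x & `|y - x| < r).
Proof.
rewrite /hausdorff_dist gt_max => /andP[hA hB].
split => x hx; apply: edist_inf_lt;
  [apply: le_lt_trans hA|apply: le_lt_trans hB];
  by apply: ereal_sup_ubound; exists x.
Qed.

(** A point of one limit is approximated by points of [K n], hence by points of the
other limit, which is closed. *)
Lemma hausdorff_lim_unique K J J' :
  is_hausdorff_lim K J -> is_hausdorff_lim K J' -> J = J'.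
Proof.
suff sub L L' : is_hausdorff_lim K L -> is_hausdorff_lim K L' -> L `<=` L'.
  by move=> h h'; apply/seteqP; split; exact: sub.
move=> [_ _ hL] [_ cL' hL'] t Lt.
have L'_closed : closed L'.
  by apply: compact_closed => //; exact: norm_hausdorff.
apply: L'_closed => U /nbhs_ballP[e /= e0 eU].
have e20 : (0 < (e / 2)%:E)%E by rewrite lte_fin divr_gt0.
have [n [h h']] : exists n, (hausdorff_dist (K n) L < (e / 2)%:E)%E /\
    (hausdorff_dist (K n) L' < (e / 2)%:E)%E.
  have near_lt M : hausdorff_dist (K n) M @[n --> \oo] --> 0%E ->
      \forall n \near \oo, (hausdorff_dist (K n) M < (e / 2)%:E)%E.
    by move=> /(_ [set y | (y < (e / 2)%:E)%E]); apply; exact: open_ereal_lt'.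
  exact: filter_ex (filterI (near_lt _ hL) (near_lt _ hL')).
have [x Kx tx] := (hausdorff_dist_lt h).2 t Lt.
have [s Ls xs] := (hausdorff_dist_lt h').1 x Kx.
exists s; split => //; apply: eU; rewrite /ball /=.
rewrite (_ : t - s = (t - x) + (x - s)); last by ring.
by rewrite (le_lt_trans (ler_normD _ _))// (splitr e) ltrD.
Qed.

End Hausdorff.

Section JointSpectrum.
Context {R : realType}.
Local Notation l := (ln golden : R).

Lemma prod_setE n :
  prod_set (S_ab R) n = [set wordmx w | w in [set w | size w = n]].
Proof.
apply/seteqP; split => [_ [g hg <-]|_ [w wn <-]].
  exists [seq g i == mat_a R | i <- index_enum 'I_n] => /=.
    by rewrite size_map [index_enum _]unlock -enumT size_enum_ord.
  rewrite /wordmx big_map; apply: eq_bigr => i _.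
  by rewrite /letter; case: eqP => // ?; case: (hg i).
exists (fun i : 'I_n => letter (nth false w i)) => /=.
  by move=> i; rewrite /letter; case: nth; [left|right].
by rewrite /wordmx (big_nth false) wn big_mkord.
Qed.

Lemma ln_golden_gt0 : 0 < l.
Proof. by rewrite ln_gt0// golden_gt1. Qed.

Lemma cartan_le_ln_mass w : cartan (wordmx w : 'M[R]_2) <= ln_mass w.
Proof.
have hw : nonneg (wordmx w : 'M[R]_2) by exact: nonneg_wordmx.
have h0 : 0 < op_norm (wordmx w : 'M[R]_2).
  by rewrite (lt_le_trans _ (corner_le_op_norm hw))//
  (lt_le_trans _ (corner_ge1 w)).
rewrite /cartan ler_ln ?posrE ?op_norm_le_mass//.
exact: lt_le_trans (op_norm_le_mass hw).
Qed.

Lemma ln_corner_le_cartan w : ln_corner w <= cartan (wordmx w : 'M[R]_2).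
Proof.
have hw : nonneg (wordmx w : 'M[R]_2) by exact: nonneg_wordmx.
have c0 : 0 < corner (wordmx w : 'M[R]_2) by exact: lt_le_trans (corner_ge1 w).
rewrite /cartan ler_ln ?posrE ?corner_le_op_norm//.
exact: lt_le_trans (corner_le_op_norm hw).
Qed.

Lemma ln_mass_le w : ln_mass w <= (size w).+2%:R * l.
Proof.
rewrite mulr_natl -lnXn ?golden_gt0// ler_ln ?posrE ?exprn_gt0 ?golden_gt0//.
  exact: mass_wordmx_le.
exact: lt_le_trans (mass_ge1 w).
Qed.

(** The alternating part grows at the extremal rate and the power of [a] only
linearly, so [j] tunes the logarithm of the norm. *)
Definition interpolating_word j m := alternating true j ++ nseq m true.

Lemma cartan_interpolating_word j m :
  `|j%:R * l - cartan (wordmx (interpolating_word j m) : 'M[R]_2)|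
    <= 2 * l + 2 * ln (j + m).+2%:R.
Proof.
have c1 : j%:R * l <= ln_mass (alternating true j) :> R.
  rewrite mulr_natl -lnXn ?golden_gt0// ler_ln ?posrE ?exprn_gt0 ?golden_gt0//.
    exact: mass_alternating.
  exact: lt_le_trans (mass_ge1 _).
have c2 := @ln_mass_le_corner R (alternating true j).
have c3 := @ln_mass_le_corner R (nseq m true).
have c4 := @ln_mass_le (alternating true j).
have c5 := @ln_mass_subadditive R (alternating true j) (nseq m true).
have c6 := @ln_corner_superadditive R (alternating true j) (nseq m true).
have c7 := @ln_corner_ge0 R (nseq m true).
have c8 := cartan_le_ln_mass (interpolating_word j m).
have c9 := ln_corner_le_cartan (interpolating_word j m).
have l0 := ln_golden_gt0.
have mono i : (i <= j + m)%N -> ln i.+2%:R <= ln (j + m).+2%:R :> R.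
  by move=> hi; rewrite ler_ln ?posrE// ler_nat.
have m1 := mono _ (leq_addr m j); have m2 := mono _ (leq_addl j m).
rewrite /interpolating_word in c8 c9 *; rewrite size_alternating in c2 c4.
rewrite size_nseq {1}/ln_corner corner_nseq ln1 in c3.
rewrite -(natr1 j.+1) -(natr1 j) in c4.
by rewrite ler_norml; apply/andP; split; lra.
Qed.

Definition norm_log_set n : set R :=
  [set n%:R^-1 * cartan g | g in prod_set (S_ab R) n].

(** In the numerator, [2 l] and the logarithm bound the error of
[cartan_interpolating_word], [l] is the cost of rounding [n t / l] to an integer,
and [1] makes the inequalities strict. *)
Definition spectrum_err n : R := (3 * l + 1 + 2 * ln n.+2%:R) / n%:R.

Lemma spectrum_err_gt0 n : (0 < n)%N -> 0 < spectrum_err n.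
Proof.
move=> n0; rewrite divr_gt0 ?ltr0n//.
have := ln_golden_gt0; have : 0 <= ln n.+2%:R :> R by rewrite ln_ge0// ler1n.
lra.
Qed.

Lemma norm_log_set_bound n x : (0 < n)%N -> norm_log_set n x ->
  0 <= x < l + spectrum_err n.
Proof.
move=> n0 [g]; rewrite prod_setE => -[w /= wn <-] <-.
have nR : 0 < n%:R :> R by rewrite ltr0n.
have h1 := ln_corner_le_cartan w; have h2 := cartan_le_ln_mass w.
have h3 := @ln_corner_ge0 R w; have h4 := ln_mass_le w.
have l0 := ln_golden_gt0.
have h5 : 0 <= ln n.+2%:R :> R by rewrite ln_ge0// ler1n.
rewrite wn -(natr1 n.+1) -(natr1 n) in h4.
have k0 := le_trans h3 h1; rewrite mulrC divr_ge0//= ltr_pdivrMr//.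
rewrite mulrDl /spectrum_err divfK ?gt_eqF//; lra.
Qed.

Lemma norm_log_set_dense n t : (0 < n)%N -> 0 <= t <= l ->
  exists2 x, norm_log_set n x & `|t - x| < spectrum_err n.
Proof.
move=> n0 /andP[t0 tl]; have l0 := ln_golden_gt0.
have nR : 0 < n%:R :> R by rewrite ltr0n.
pose j := Num.truncn (n%:R * t / l).
have nt0 : 0 <= n%:R * t / l by rewrite divr_ge0 ?mulr_ge0// ltW.
have /andP[j1 j2] := truncn_itv nt0.
rewrite -/j ler_pdivlMr// in j1; rewrite -/j ltr_pdivrMr// -natr1 in j2.
have jn : (j <= n)%N.
  rewrite -(@ler_nat R) -(ler_pM2r l0) (le_trans j1)// ler_pM2l//.
have := cartan_interpolating_word j (n - j); rewrite subnKC//.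
set k := cartan _ => hk.
exists (n%:R^-1 * k).
  exists (wordmx (interpolating_word j (n - j))) => //.
  rewrite prod_setE; exists (interpolating_word j (n - j)) => //=.
  by rewrite size_cat size_alternating size_nseq subnKC.
rewrite -(ltr_pM2l nR) -[X in X * `|_|](gtr0_norm nR) -normrM mulrBr.
rewrite mulrA divff ?gt_eqF// mul1r [ltRHS]mulrC /spectrum_err divfK ?gt_eqF//.
move: hk; rewrite ler_norml ltr_norml => /andP[k1 k2].
by apply/andP; split; lra.
Qed.

Lemma cvg_spectrum_err : spectrum_err n @[n --> \oo] --> 0.
Proof. exact: cvg_le_ln_div. Qed.

Lemma joint_spectrum_lim : is_hausdorff_lim norm_log_set `[0, l].
Proof.
have l0 := ln_golden_gt0.
split; [by exists 0; rewrite /= in_itv /= lexx ltW|exact: segment_compact|].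
have : (spectrum_err n)%:E @[n --> \oo] --> 0%:E.
  by apply: cvg_EFin; [exact: nearW|exact: cvg_spectrum_err].
apply: squeeze_cvge; last exact: cvg_cst.
near=> n.
have n0 : (0 < n)%N by near: n; exact: nbhs_infty_gt.
have e0 := spectrum_err_gt0 n0.
rewrite hausdorff_dist_ge0/=; last first.
  have [|x Kx _] := @norm_log_set_dense n 0 n0; last by exists x.
  by rewrite lexx ltW.
apply: hausdorff_dist_le => // [x /(norm_log_set_bound n0)/andP[x0 xl]|t].
  exists (Num.min x l).
    by rewrite /= in_itv /= le_min x0 ltW//= ge_min lexx orbT.
  have [xl'|xl'] := leP x l; first by rewrite subrr normr0.
  by rewrite ger0_norm ?subr_ge0 ?ltW// ltrBlDl.
by rewrite /= in_itv /=; exact: norm_log_set_dense.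
Unshelve. all: by end_near. Qed.

Lemma joint_spectrumE : joint_spectrum (S_ab R) = `[0, l]%classic.
Proof.
apply: xget_unique; first exact: joint_spectrum_lim.
by move=> J hJ; exact: hausdorff_lim_unique hJ joint_spectrum_lim.
Qed.

Lemma powR_norm_set n : (0 < n)%N ->
  [set op_norm g `^ n%:R^-1 | g in prod_set (S_ab R) n] =
  expR @` norm_log_set n.
Proof.
move=> n0; rewrite /norm_log_set [RHS]image_comp; apply: eq_imagel => g.
rewrite prod_setE => -[w _ <-].
have hw : nonneg (wordmx w : 'M[R]_2) by exact: nonneg_wordmx.
rewrite /powR gt_eqF//.
by rewrite (lt_le_trans _ (corner_le_op_norm hw))//
  (lt_le_trans _ (corner_ge1 w)).
Qed.

Lemma joint_spectral_radiusE : joint_spectral_radius (S_ab R) = golden.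
Proof.
have l0 := ln_golden_gt0.
apply: cvg_lim => //; rewrite -(lnK (golden_gt0 : golden \is Num.pos)).
have hlo : expR (l - spectrum_err n) @[n --> \oo] --> expR l.
  apply: continuous_cvg; first exact: continuous_expR.
  rewrite -[X in _ --> X]subr0.
  by apply: cvgB; [exact: cvg_cst|exact: cvg_spectrum_err].
have hup : expR (l + spectrum_err n) @[n --> \oo] --> expR l.
  apply: continuous_cvg; first exact: continuous_expR.
  rewrite -[X in _ --> X]addr0.
  by apply: cvgD; [exact: cvg_cst|exact: cvg_spectrum_err].
apply: squeeze_cvgr hlo hup; near=> n.
have n0 : (0 < n)%N by near: n; exact: nbhs_infty_gt.
rewrite powR_norm_set//.
have [|x Kx hx] := @norm_log_set_dense n l n0; first by rewrite lexx ltW.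
have ub y : (expR @` norm_log_set n) y -> y <= expR (l + spectrum_err n).
  by move=> [z /(norm_log_set_bound n0)/andP[_ zl] <-]; rewrite ler_expR ltW.
apply/andP; split.
  apply: (@le_trans _ _ (expR x)).
    by rewrite ler_expR; move: hx; rewrite ltr_norml => /andP[]; lra.
  by apply: ub_le_sup; [exists (expR (l + spectrum_err n))|exists x].
by apply: ge_sup => //; exists (expR x), x.
Unshelve. all: by end_near. Qed.

End JointSpectrum.

(** * The image of the Lyapunov function *)

(** [c] maximizes [lyap] on [[0, 1]]; the intermediate values are taken on [[0, c]]. *)
Lemma lyap_image {R : realType} : exists c : R, [/\ 0 < c < 1,
  forall p, 0 < p < 1 -> lyap p <= lyap c &
  forall y, 0 < y <= lyap c -> exists2 p, 0 < p < 1 & lyap p = y].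
Proof.
pose f (x : R) := lyap (Num.max 0 (Num.min x 1)).
have fE x : 0 <= x <= 1 -> f x = lyap x.
  by move=> /andP[x0 x1]; rewrite /f (min_idPl x1) (max_idPr x0).
have fc a b : {within `[a, b], continuous f}.
  by apply: continuous_subspaceT; exact: lyap_continuous.
have [c] := EVT_max ler01 (fc 0 1); rewrite in_itv /= => c01 cmax.
have {}cmax p : 0 < p < 1 -> lyap p <= lyap c.
  move=> /andP[p0 p1]; have p01 : 0 <= p <= 1 by rewrite !ltW.
  by rewrite -(fE _ p01) -(fE _ c01); apply: cmax; rewrite in_itv.
have half : 0 < (2^-1 : R) < 1 by rewrite invr_gt0 ltr0n /= invf_lt1 ?ltr1n.
have c_gt0 : 0 < lyap c by rewrite (lt_le_trans (lyap_gt0 half))// cmax.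
have c0 : c != 0 by apply: contraTneq c_gt0 => ->; rewrite lyap0 ltxx.
have c1 : c != 1 by apply: contraTneq c_gt0 => ->; rewrite lyap1 ltxx.
have {c0 c1} c01' : 0 < c < 1 by rewrite !lt_neqAle c1 eq_sym c0.
exists c; split => // y /andP[y0 yc].
have f0 : f 0 = 0 by rewrite fE ?lyap0// lexx ler01.
have hy : Num.min (f 0) (f c) <= y <= Num.max (f 0) (f c).
  by rewrite f0 fE// (min_idPl (ltW c_gt0)) (max_idPr (ltW c_gt0)) (ltW y0).
have [|p] := IVT _ (fc 0 c) hy; first by case/andP: c01.
rewrite in_itv /= => /andP[p0 pc] fp.
have p1 : p < 1 by rewrite (le_lt_trans pc)//; case/andP: c01'.
have yp : lyap p = y by rewrite -fp fE// p0 ltW.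
exists p => //; rewrite p1 andbT lt_neqAle p0 andbT eq_sym.
by apply: contraTneq y0 => p0'; rewrite -yp p0' lyap0 ltxx.
Qed.

Unset Implicit Arguments.

Theorem proposition1p10 (R : realType) :
  [/\ joint_spectrum (S_ab R) =
        `[0, ln (joint_spectral_radius (S_ab R))]%classic,
      0 < ln (joint_spectral_radius (S_ab R)) &
      exists R' : R,
        [/\ 0 < R', R' < joint_spectral_radius (S_ab R) &
            [set l | exists (p : R) (p01 : 0 < p < 1),
                       l = lyapunov_exponent (mu_ab p01)]
            = `]0, ln R']%classic]].
Proof.
rewrite joint_spectral_radiusE joint_spectrumE; split => //.
  exact: ln_golden_gt0.
have [c [c01 cmax civt]] := @lyap_image R.
exists (expR (lyap c)); split; first exact: expR_gt0.
  by rewrite -[ltRHS]lnK ?posrE ?golden_gt0// ltr_expR lyap_lt_ln_golden.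
rewrite expRK; apply/seteqP; split => y /=; rewrite in_itv /=.
  by move=> [p [p01 ->]]; rewrite lyapunov_exponentE lyap_gt0//= cmax.
by move=> /civt[p p01 <-]; exists p, p01; rewrite lyapunov_exponentE.
Qed.
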